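(* Let $K\subseteq\mathbb{R}^n$ be compact, let $X\subseteq K$ be a finite set, let $\mu$ be a (not necessarily discrete) positive measure on $K$, and let $\Delta$ be a positive measure with at most $k$ atoms, supported on $X$. Suppose that the ideal $I(X)\subseteq\mathbb{R}[x_1,\dots,x_n]$ of polynomials vanishing on $X$ admits a set of $s$ generators of degree $\leq g$. Then there exists a positive constant $D$ such that for all sufficiently large even integers $m$ the following holds. Let $d\geq2(m-1)g$, let $\phi_1,\dots,\phi_T$ be a basis of $V_{\leq d}$ which is orthonormal with respect to some probability measure on $K$, let $\delta\geq0$ be such that $\Delta$ is a $(\delta,k)$-summary of $\mu$ with respect to $\phi_1,\dots,\phi_T$, and let $\hat\Delta$ be a discrete minimizer of $$\min_{\nu\in\mathcal{S}(K)}\|\nu\|_{\rm TV}\quad\text{subject to}\quad\left\|\left(\int_K\phi_i\,d\nu-\int_K\phi_i\,d\mu\right)_{i=1,\dots,T}\right\|_2\leq\delta.$$ Set $c_0:=\frac1m\sqrt{\frac{3!}{D}}$. Then: 1. If $z\in K$ is such that $\hat\Delta(z)>4s\delta$ then $d(X,z)\leq c_0$. 2. The following inequalities hold: $$\sum_{z\in N(X,c_0),\ \hat\Delta(z)>0}\hat\Delta(z)\,d(X,z)^2\leq\left(\frac{3!\cdot 4s}{m^2D}\right)\delta,$$ $$\sum_{z\in F(X,c_0),\ \hat\Delta(z)>0}\hat\Delta(z)\leq2s\delta,$$ $$\sum_{z:\ \hat\Delta(z)<0}|\hat\Delta(z)|\leq2\delta.$$ 3. If $x^*\in X$ then $$\left|\Delta(x^*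 )-\sum_{z:\ d(z,x^* )\leq c_0}\hat\Delta(z)\right|\leq\frac1m\|\Delta\|_{\rm TV}+\left(2(s+1)+\frac{3!\cdot 2s\pi^2}{\mathrm{diam}(K)^2D}\right)\delta.$$
   Context: $V_{\leq d}$ is the vector space of real polynomials in $n$ variables of degree at most $d$. A $(\delta,k)$-summary of a positive measure $\mu$ on $K$ with respect to $\phi_1,\dots,\phi_T$ is a positive measure $\Delta$ on $K$ with at most $k$ atoms (a combination of at most $k$ Dirac measures with nonnegative coefficients) such that $$\left\|\left(\int_K\phi_i\,d\mu-\int_K\phi_i\,d\Delta\right)_{i=1,\dots,T}\right\|_2\leq\delta.$$ $\mathcal{S}(K)$ is the set of all real-valued signed Borel measures on $K$, and $\|\nu\|_{\rm TV}:=\sup\{\int_K f\,d\nu: f\text{ continuous on }K,\ \|f\|_\infty\leq1\}$. A discrete minimizer is a minimizer that is a finite real linear combination of Dirac measures at points of $K$. For a discrete (signed) measure $\Delta$ and $z\in K$, $\Delta(z)$ denotes the coefficient of $\delta_z$ in the unique decomposition of $\Delta$ as a linear combination of Dirac measures. $d(X,z)=d(z,X)$ is the Euclidean distance from $z$ to $X$, and $d(z,x^* )$ the Euclidean distance between two points. $N(X,r)$ (resp. $F(X,r)$) is the set of points of $K$ at distance at most (resp. at least) $r$ from $X$. $\mathrm{diam}(K)$ is the largest distance between two points of $K$. All measures are finite Borel measures. *)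

(* Defs.v *)
From HB Require Import structures.
From mathcomp Require Import all_boot all_order all_algebra.
From mathcomp Require Import all_classical all_reals all_analysis.
(* The notations of mpoly clash with those of mathcomp-analysis. *)
From mathcomp Require mpoly.
Import -(notations) mpoly.

Set Implicit Arguments.
Unset Strict Implicit.
Unset Printing Implicit Defensive.

Import Order.TTheory GRing.Theory Num.Theory.
Import numFieldNormedType.Exports.
Local Open Scope classical_set_scope.
Local Open Scope ring_scope.

(* R^n with its Borel sigma-algebra. The topology of 'rV[R]_n comes from the
   sup norm, so it is the Euclidean one. *)
Definition borelRn (R : realType) (n : nat) :=
  g_sigma_algebraType (@open 'rV[R]_n).

Section Geometry.
Context {R : realType} {n : nat}.
Implicit Types (x y z : 'rV[R]_n) (X K : set 'rV[R]_n).

(* The norm of 'rV[R]_n in the library is the sup norm, hence this definition. *)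
Definition dist2 x y : R := Num.sqrt (\sum_i (x ord0 i - y ord0 i) ^+ 2).

(* Extended-real valued: the distance to the empty set is +oo. *)
Definition dist_set X z : \bar R := ereal_inf [set (dist2 z x)%:E | x in X].

Definition near_set K X (r : R) : set 'rV[R]_n :=
  [set z | K z /\ (dist_set X z <= r%:E)%E].

Definition far_set K X (r : R) : set 'rV[R]_n :=
  [set z | K z /\ (r%:E <= dist_set X z)%E].

Definition diameter K : R :=
  sup [set r | exists x y, [/\ K x, K y & r = dist2 x y]].

End Geometry.

Section Polynomials.
Context {R : realType} {n : nat}.
Implicit Types (p q : mpoly n R) (X : set 'rV[R]_n).

Definition peval p (x : 'rV[R]_n) : R := meval (x ord0) p.

(* msize is the total degree plus one, and 0 for the zero polynomial. *)
Definition degree_le (d : nat) p : Prop := (msize p <= d.+1)%N.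

Definition vanishing_ideal X : set (mpoly n R) :=
  [set p | forall x, X x -> peval p x = 0].

Definition ideal_span (s : nat) (h : 'I_s -> mpoly n R) : set (mpoly n R) :=
  [set q | exists a : 'I_s -> mpoly n R, q = \sum_(i < s) a i * h i].

Definition is_basis_degree_le (d T : nat) (phi : 'I_T -> mpoly n R) : Prop :=
  [/\ forall i, degree_le d (phi i),
      forall a : 'I_T -> R,
        \sum_(i < T) a i *: phi i = 0 -> forall i, a i = 0
    & forall p, degree_le d p ->
        exists a : 'I_T -> R, p = \sum_(i < T) a i *: phi i].

End Polynomials.

Section Measures.
Context {R : realType} {n : nat}.
Local Notation E := (borelRn R n).
Implicit Types (K : set E) (nu : {charge set E -> \bar R}).

(* Measures on K are represented by Borel measures on R^n living on K. *)
Definition lives_on K (m : set E -> \bar R) : Prop :=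
  forall A, measurable A -> A `&` K = set0 -> m A = 0%E.

(* The value does not depend on the Hahn decomposition that is chosen. *)
Definition charge_integral nu K (f : E -> R) : R :=
  let P := cid (Hahn_decomposition nu) in
  let N := cid (projT2 P) in
  Rintegral (jordan_pos (projT2 N)) K f - Rintegral (jordan_neg (projT2 N)) K f.

Definition tv_norm K nu : R :=
  sup [set r | exists f : 'rV[R]_n -> R,
    [/\ {within (K : set 'rV[R]_n), continuous f},
        forall x, K x -> `|f x| <= 1
      & r = charge_integral nu K f]].

Definition coef_support (c : E -> R) : set E := [set z | c z != 0].

(* c z is the coefficient of delta_z in the discrete measure m. *)
Definition dirac_decomposition K (m : set E -> \bar R) (c : E -> R) : Prop :=
  [/\ finite_set (coef_support c),
      coef_support c `<=` K
    & forall A, measurable A ->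
        m A = (\sum_(z \in coef_support c) (c z)%:E * dirac z A)%E].

Definition has_atoms_at_most K (k : nat) (m : set E -> \bar R) : Prop :=
  exists c : E -> R, [/\ dirac_decomposition K m c,
    forall z, 0 <= c z & (coef_support c #<= `I_k)%card].

Definition is_orthonormal K (T : nat) (rho : {measure set E -> \bar R})
    (phi : 'I_T -> mpoly n R) : Prop :=
  forall i j : 'I_T,
    Rintegral rho K (fun x => peval (phi i) x * peval (phi j) x) = (i == j)%:R.

Definition norm2 (T : nat) (v : 'I_T -> R) : R :=
  Num.sqrt (\sum_(i < T) v i ^+ 2).

Definition is_summary K (T : nat) (phi : 'I_T -> mpoly n R) (delta : R)
    (k : nat) (mu Delta : {finite_measure set E -> \bar R}) : Prop :=
  has_atoms_at_most K k Delta /\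
  norm2 (fun i => Rintegral mu K (peval (phi i))
                  - Rintegral Delta K (peval (phi i))) <= delta.

Definition is_feasible K (T : nat) (phi : 'I_T -> mpoly n R) (delta : R)
    (mu : {finite_measure set E -> \bar R}) nu : Prop :=
  lives_on K nu /\
  norm2 (fun i => charge_integral nu K (peval (phi i))
                  - Rintegral mu K (peval (phi i))) <= delta.

Definition is_minimizer K (T : nat) (phi : 'I_T -> mpoly n R) (delta : R)
    (mu : {finite_measure set E -> \bar R}) nu : Prop :=
  is_feasible K phi delta mu nu /\
  forall nu' : {charge set E -> \bar R},
    is_feasible K phi delta mu nu' -> tv_norm K nu <= tv_norm K nu'.

End Measures.

(* Main.v *)
(* Duality with polynomial witnesses. Both the minimizer, with coefficients b,
   and Delta have moments within delta of those of mu, and the basis is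
   orthonormal for a probability measure on K, so the two measures differ by at
   most 2 delta on every polynomial of degree <= d bounded by 1 on K. If such a
   q equals 1 on X, then minimality gives
     sum |b| <= |Delta| <= sum b q + 2 delta,
   hence the sum of b (1 - q) over b > 0 is at most 2 delta. The witnesses are
   q_i = P(h_i), where P is a shifted and rescaled Chebyshev polynomial of
   degree 2 (m - 1) with P(0) = 1 that drops below 0 at distance O(1/m) from 0,
   and 1 - P(t) is at least min(1, c m^2 t^2). Since the h_i generate I(X),
   their squares sum to at least a multiple of d(z, X)^2 on K, which gives the
   first two parts. For the last part one tests against a polynomial that
   interpolates the indicator of x* on X to second order: its error is
   O(d(z, X)^2) near X, hence controlled by the same sum. The constant D is
   chosen small enough to absorb the sup norm of this interpolant. *)

Require Import Defs.
From HB Require Import structures.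
From mathcomp Require Import all_boot all_order all_algebra.
From mathcomp Require Import all_classical all_reals all_analysis.
From mathcomp Require mpoly.
Import -(notations) mpoly.
From mathcomp Require Import ring lra zify.
From mathcomp Require Import measurable_realfun.

Set Implicit Arguments.
Unset Strict Implicit.
Unset Printing Implicit Defensive.

Import Order.TTheory GRing.Theory Num.Theory.
Import numFieldNormedType.Exports.
Local Open Scope classical_set_scope.
Local Open Scope ring_scope.

(** * Chebyshev peak polynomials *)

(* The pair (T_n(y), U_(n-1)(y)) of Chebyshev values. Compared with the
   three-term recurrence, this recursion has only nonnegative terms for
   y >= 1 and makes the Pell identity immediate. *)
Fixpoint cheb (A : pzRingType) (y : A) (k : nat) : A * A :=
  if k is k'.+1 then
    let: (T, U) := cheb y k' in (y * T + (y ^+ 2 - 1) * U, T + y * U)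
  else (1, 0).

Lemma chebS (A : pzRingType) (y : A) k :
  cheb y k.+1 = (y * (cheb y k).1 + (y ^+ 2 - 1) * (cheb y k).2,
                 (cheb y k).1 + y * (cheb y k).2).
Proof. by rewrite /=; case: (cheb y k). Qed.

Lemma rmorph_cheb (A B : pzRingType) (f : {rmorphism A -> B}) (y : A) k :
  f (cheb y k).1 = (cheb (f y) k).1 /\ f (cheb y k).2 = (cheb (f y) k).2.
Proof.
elim: k => [|k [IH1 IH2]]; first by rewrite /= rmorph1 rmorph0.
by rewrite !chebS /= !(rmorphXn, rmorphD, rmorphM, rmorphN, rmorph1) IH1 IH2.
Qed.

Section ChebyshevReal.
Variable R : realFieldType.
Implicit Types (y e t : R) (k : nat).

(** With r = sqrt (y^2 - 1), the pair encodes T + U r = (y + r)^k, and y + r has norm 1. *)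
Lemma cheb_pell y k :
  (cheb y k).1 ^+ 2 + (1 - y ^+ 2) * (cheb y k).2 ^+ 2 = 1.
Proof.
elim: k => [|k IH]; first by rewrite /=; ring.
by rewrite chebS /= -[RHS]IH; ring.
Qed.

Lemma cheb_le1 y k : `|y| <= 1 -> `|(cheb y k).1| <= 1.
Proof.
move=> y1; have y21 : y ^+ 2 <= 1 by rewrite -real_normK ?num_real// expr_le1.
rewrite -(expr_le1 (n := 2))// real_normK ?num_real//.
have := cheb_pell y k; set u := (cheb y k).2.
have : 0 <= (1 - y ^+ 2) * u ^+ 2 by rewrite mulr_ge0 ?subr_ge0 ?sqr_ge0.
by lra.
Qed.

(** At y = 1 + e the first component grows by e T + (2 e + e^2) U at each step. By induction on both
    components this is at least (2 k + 1) e, and these odd numbers add up to squares. *)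
Lemma cheb_ge1 e k : 0 <= e ->
  1 + k%:R ^+ 2 * e <= (cheb (1 + e) k).1 /\ k%:R <= (cheb (1 + e) k).2.
Proof.
move=> e0; elim: k => [|k [IH1 IH2]]; first by rewrite /= !expr0n/=; lra.
rewrite chebS /= -natr1; set T := (cheb _ _).1 in IH1 *.
set U := (cheb _ _).2 in IH2 *; set x := k%:R in IH1 IH2 *.
have x0 : 0 <= x by exact: ler0n.
have ex : 0 <= e * x by rewrite mulr_ge0.
have exx : 0 <= e * x ^+ 2 by rewrite mulr_ge0 ?sqr_ge0.
have T1 : 0 <= T - 1 by nra.
have := mulr_ge0 e0 T1.
have : 0 <= e * (U - x) by rewrite mulr_ge0 ?subr_ge0.
have : 0 <= e ^+ 2 * U by rewrite mulr_ge0 ?sqr_ge0 ?(le_trans x0).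
by split; nra.
Qed.

(* Convexity of T_k along the segment from 1 to 1 + e: the bound at the point
   1 + t * e is the chord through (1, 1) and (1 + e, T_k(1 + e)). *)
Lemma cheb_chord e t k : 0 <= e -> 0 <= t <= 1 ->
  (cheb (1 + t * e) k).1 - 1 <= t * ((cheb (1 + e) k).1 - 1).
Proof.
move=> e0 /andP[t0 t1].
have te0 : 0 <= t * e by rewrite mulr_ge0.
(* The chord bound alone does not propagate: comparing the increments at [1 + t * e] and at [1 + e]
   takes monotonicity of both components. *)
suff [] : [/\ (cheb (1 + t * e) k).1 - 1 <= t * ((cheb (1 + e) k).1 - 1),
  (cheb (1 + t * e) k).1 <= (cheb (1 + e) k).1 &
  (cheb (1 + t * e) k).2 <= (cheb (1 + e) k).2] by [].
elim: k => [|k]; first by rewrite /=; split; lra.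
have := cheb_ge1 k e0; have := cheb_ge1 k te0; rewrite !chebS /=.
set T := (cheb (1 + e) k).1; set U := (cheb (1 + e) k).2.
set T' := (cheb (1 + t * e) k).1; set U' := (cheb (1 + t * e) k).2.
set x := k%:R => -[T1' U1'] [T1 U1] [h1 h2 h3].
have x0 : 0 <= x by exact: ler0n.
have xt : 0 <= x ^+ 2 * (t * e) by rewrite mulr_ge0 ?sqr_ge0.
have tee : t * e <= e by rewrite ler_piMl.
have T'0 : 0 <= T' by lra.
have U'0 : 0 <= U' by lra.
have le1 : T' + (2 + t * e) * U' <= T + (2 + e) * U.
  by rewrite lerD// ler_pM//; lra.
have ge0 : 0 <= T' + (2 + t * e) * U' by rewrite addr_ge0// mulr_ge0//; lra.
have le2 : t * e * (T' + (2 + t * e) * U') <= t * e * (T + (2 + e) * U).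
  by rewrite ler_wpM2l.
have le3 : t * e * U' <= e * U by rewrite ler_pM.
have le4 : t * e * (T + (2 + e) * U) <= e * (T + (2 + e) * U).
  by rewrite ler_wpM2r// (le_trans ge0).
split.
- have -> : (1 + t * e) * T' + ((1 + t * e) ^+ 2 - 1) * U' - 1 =
    (T' - 1) + t * e * (T' + (2 + t * e) * U') by ring.
  have -> : t * ((1 + e) * T + ((1 + e) ^+ 2 - 1) * U - 1) =
    t * (T - 1) + t * e * (T + (2 + e) * U) by ring.
  exact: lerD.
- have -> : (1 + t * e) * T' + ((1 + t * e) ^+ 2 - 1) * U' =
    T' + t * e * (T' + (2 + t * e) * U') by ring.
  have -> : (1 + e) * T + ((1 + e) ^+ 2 - 1) * U =
    T + e * (T + (2 + e) * U) by ring.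
  by rewrite lerD// (le_trans le2).
- by rewrite !mulrDl !mul1r !addrA lerD// lerD.
Qed.

(* The peak is at t = 0, and e = 2 / k^2 makes T_k(1 + e) >= 3, so that the
   rescaled values stay above -1 where |1 + e - t^2| <= 1. *)
Definition cheb_peak k t : R :=
  let e := 2 / k%:R ^+ 2 in
  ((cheb (1 + e - t ^+ 2) k).1 - 1) / ((cheb (1 + e) k).1 - 1).

Section Peak.
Variables (k : nat) (k0 : (0 < k)%N).
Let e : R := 2 / k%:R ^+ 2.

Let kp : 0 < k%:R :> R. Proof. by rewrite ltr0n. Qed.

Let e0 : 0 <= e. Proof. by rewrite divr_ge0 ?sqr_ge0. Qed.

Lemma cheb_peak_den_ge2 : 2 <= (cheb (1 + e) k).1 - 1.
Proof.
have [+ _] := cheb_ge1 k e0.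
rewrite /e mulrCA divff ?mulr1; first by lra.
by rewrite expf_eq0/= gt_eqF.
Qed.

Lemma cheb_peak0 : cheb_peak k 0 = 1.
Proof.
have := cheb_peak_den_ge2.
rewrite /cheb_peak expr0n subr0 -/e => h; rewrite divff//; lra.
Qed.

(** If t^2 >= e, the Chebyshev argument lies in [0, 1], so the numerator is in [-2, 0] while the
    denominator is at least 2. Otherwise the chord bound applies at u = 1 - t^2 / e, and 1 - u is
    exactly k^2 t^2 / 2. *)
Lemma cheb_peak_bound t : `|t| <= 1 ->
  `|cheb_peak k t| <= 1 /\
  Num.min 1 (k%:R ^+ 2 * t ^+ 2 / 2) <= 1 - cheb_peak k t.
Proof.
move=> t1; have t21 : t ^+ 2 <= 1.
  by rewrite -real_normK ?num_real// expr_le1.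
have t20 := sqr_ge0 t; have D2 := cheb_peak_den_ge2.
rewrite /cheb_peak -/e; set D := (cheb (1 + e) k).1 - 1 in D2 *.
have D0 : 0 < D by lra.
case: (leP e (t ^+ 2)) => et.
  have /cheb_le1 : `|1 + e - t ^+ 2| <= 1 by rewrite ler_norml; apply/andP; split; move: e0; lra.
  move=> /(_ k); set T := (cheb _ _).1; rewrite ler_norml => /andP[T1 T2].
  have h1 : (T - 1) / D <= 0 by rewrite pmulr_lle0 ?invr_gt0//; lra.
  have h2 : -1 <= (T - 1) / D by rewrite ler_pdivlMr//; lra.
  by rewrite ler_norml ge_min; split; [lra | apply/orP; left; lra].
have e1 : 0 < e by lra.
pose u := 1 - t ^+ 2 / e.
have u01 : 0 <= u <= 1.
  have : t ^+ 2 / e <= 1 by rewrite ler_pdivrMr// mul1r ltW.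
  have : 0 <= t ^+ 2 / e by rewrite divr_ge0.
  by rewrite /u; lra.
have yE : 1 + e - t ^+ 2 = 1 + u * e by rewrite /u; field; rewrite gt_eqF.
have ue : 0 <= u * e by rewrite mulr_ge0//; lra.
have := cheb_chord k e0 u01; rewrite -yE -/D.
have [+ _] := cheb_ge1 k ue; rewrite -yE; set T := (cheb _ _).1.
have : 0 <= k%:R ^+ 2 * (u * e) by rewrite mulr_ge0 ?sqr_ge0.
move=> h1 h2 h3.
have h4 : (T - 1) / D <= u by rewrite ler_pdivrMr.
have h5 : 0 <= (T - 1) / D by rewrite divr_ge0//; lra.
have -> : k%:R ^+ 2 * t ^+ 2 / 2 = 1 - u.
  by rewrite /u /e; field; rewrite gt_eqF.
by rewrite ler_norml ge_min; split; [lra | apply/orP; right; lra].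
Qed.

End Peak.
End ChebyshevReal.

(** * Polynomials on bounded sets *)

Lemma cauchy_schwarz_fin (R : realFieldType) k (u v : 'I_k -> R) :
  (\sum_i u i * v i) ^+ 2 <= (\sum_i u i ^+ 2) * (\sum_i v i ^+ 2).
Proof.
set P := \sum_i u i * v i; set A := \sum_i u i ^+ 2; set B := \sum_i v i ^+ 2.
have B0 : 0 <= B by apply: sumr_ge0 => i _; exact: sqr_ge0.
have : 0 <= \sum_i (B * u i - P * v i) ^+ 2.
  by apply: sumr_ge0 => i _; exact: sqr_ge0.
have -> : \sum_i (B * u i - P * v i) ^+ 2 = B * (B * A - P ^+ 2).
  transitivity (\sum_i (B ^+ 2 * u i ^+ 2 + (- (2 * B * P)) * (u i * v i)
                         + P ^+ 2 * v i ^+ 2)).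
    by apply: eq_bigr => i _; ring.
  by rewrite !big_split/= -!mulr_sumr -/A -/B -/P; ring.
have [B1|B1] := ltP 0 B; first by rewrite pmulr_rge0// subr_ge0 mulrC.
move=> _; have B2 : B = 0 by apply/eqP; rewrite eq_le B0 B1.
have v0 i : v i = 0.
  apply/eqP; rewrite -sqrf_eq0; move/eqP: B2.
  rewrite psumr_eq0; last by move=> j _; exact: sqr_ge0.
  by move=> /allP/(_ i); rewrite mem_index_enum => /(_ isT).
by rewrite /P big1 ?expr0n ?mulr_ge0 ?sumr_ge0// => i _; rewrite ?sqr_ge0// v0 mulr0.
Qed.

Lemma sqrrD_le (R : realFieldType) (u v : R) :
  (u + v) ^+ 2 <= 2 * (u ^+ 2 + v ^+ 2).
Proof. by have := sqr_ge0 (u - v); nra. Qed.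

Lemma common_bound (R : realDomainType) (T : eqType) (s : seq T)
    (P : T -> R -> Prop) :
  (forall x C C', C <= C' -> P x C -> P x C') ->
  (forall x, x \in s -> exists C, P x C) ->
  exists2 C, 0 <= C & forall x, x \in s -> P x C.
Proof.
move=> Pmono; elim: s => [|x s IH] H; first by exists 0.
have [C C0 HC] : exists2 C, 0 <= C & forall x, x \in s -> P x C.
  by apply: IH => y ys; apply: H; rewrite inE ys orbT.
have [D HD] := H x (mem_head _ _).
exists (Num.max C D); first by rewrite le_max C0.
move=> y; rewrite inE => /predU1P[->|/HC].
  by apply: Pmono HD; rewrite le_max lexx orbT.
by move=> Py; apply: Pmono Py; rewrite le_max lexx.
Qed.

Section PolyAlg.
Context {R : realType} {n : nat}.
Implicit Types (p q : mpoly n R) (x y z : 'rV[R]_n).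

Definition mvar (i : 'I_n) : mpoly n R := mpolyX R (mnm1 i).

(** Constants and variables generate the polynomial ring, so properties stable under sums and
    products (boundedness, Lipschitz bounds, continuity) reach every polynomial. *)
Lemma mpoly_alg_ind (P : mpoly n R -> Prop) :
  (forall c, P (mpolyC n c)) -> (forall i, P (mvar i)) ->
  (forall p q, P p -> P q -> P (p + q)) ->
  (forall p q, P p -> P q -> P (p * q)) -> forall p, P p.
Proof.
move=> PC PX PD PM; apply: mpolyind => [|c m p _ _ Pp].
  by rewrite -(mpolyC0 n R).
apply: PD => //; rewrite -mul_mpolyC; apply: (PM) => //.
rewrite mpolyXE_id; apply: big_ind => [|x y|i _]; [|exact: PM|].
  by rewrite -(mpolyC1 n R); exact: PC.
elim: (m i) => [|k IH]; first by rewrite expr0 -(mpolyC1 n R); exact: PC.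
by rewrite exprS; exact: (PM _ _ (PX i) IH).
Qed.

Lemma pevalD p q z : peval (p + q) z = peval p z + peval q z.
Proof. exact: mevalD. Qed.
Lemma pevalN p z : peval (- p) z = - peval p z.
Proof. exact: mevalN. Qed.
Lemma pevalM p q z : peval (p * q) z = peval p z * peval q z.
Proof. exact: mevalM. Qed.
Lemma pevalZ c p z : peval (c *: p) z = c * peval p z.
Proof. exact: mevalZ. Qed.
Lemma pevalX p k z : peval (p ^+ k) z = peval p z ^+ k.
Proof. exact: rmorphXn. Qed.
Lemma pevalC c z : peval (mpolyC n c) z = c.
Proof. exact: mevalC. Qed.
Lemma peval_var i z : peval (mvar i) z = z ord0 i.
Proof. exact: mevalXU. Qed.
Lemma peval_sum I (r : seq I) (P : pred I) (F : I -> mpoly n R) z :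
  peval (\sum_(i <- r | P i) F i) z = \sum_(i <- r | P i) peval (F i) z.
Proof. exact: raddf_sum. Qed.
Lemma peval_prod I (r : seq I) (P : pred I) (F : I -> mpoly n R) z :
  peval (\prod_(i <- r | P i) F i) z = \prod_(i <- r | P i) peval (F i) z.
Proof. exact: rmorph_prod. Qed.

Definition pevalE :=
  (pevalD, pevalN, pevalM, pevalZ, pevalX, pevalC, peval_var, peval_sum,
   peval_prod).

Lemma degree_leS d d' p : (d <= d')%N -> degree_le d p -> degree_le d' p.
Proof. by move=> dd' /leq_trans; apply; rewrite ltnS. Qed.

Lemma degree_leC d c : degree_le d (mpolyC n c : mpoly n R).
Proof. by rewrite /degree_le msizeC; case: (_ == 0). Qed.

Lemma degree_leD d p q : degree_le d p -> degree_le d q -> degree_le d (p + q).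
Proof.
move=> dp dq; apply: leq_trans (msizeD_le p q) _; by rewrite geq_max dp.
Qed.

Lemma degree_leN d p : degree_le d p -> degree_le d (- p).
Proof. by rewrite /degree_le msizeN. Qed.

Lemma degree_leM d d' p q :
  degree_le d p -> degree_le d' q -> degree_le (d + d') (p * q).
Proof.
have [->|p0] := eqVneq p 0; first by rewrite mul0r /degree_le msize0.
have [->|q0] := eqVneq q 0; first by rewrite mulr0 /degree_le msize0.
move: p0 q0; rewrite /degree_le => p0 q0 dp dq; rewrite msizeM//.
have := p0; have := q0; rewrite -!msize_poly_eq0 -!lt0n.
move: (mmeasure _ p) (mmeasure _ q) dp dq => u v; lia.
Qed.

End PolyAlg.

Section BoundedSets.
Context {R : realType} {n : nat}.
Implicit Types (p q : mpoly n R) (x y z : 'rV[R]_n) (s : seq 'rV[R]_n).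

Definition sqdist x y : R := \sum_i (x ord0 i - y ord0 i) ^+ 2.

Lemma sqdist_ge0 x y : 0 <= sqdist x y.
Proof. by apply: sumr_ge0 => i _; exact: sqr_ge0. Qed.

Lemma sqdistC x y : sqdist x y = sqdist y x.
Proof. by apply: eq_bigr => i _; rewrite -sqrrN opprB. Qed.

Lemma sqdist_eq0 x y : (sqdist x y == 0) = (x == y).
Proof.
apply/idP/eqP => [|->]; last by rewrite /sqdist big1// => i _; rewrite subrr expr0n.
rewrite psumr_eq0; last by move=> i _; exact: sqr_ge0.
move=> /allP h; apply/rowP => i; apply/eqP.
by have := h i; rewrite mem_index_enum sqrf_eq0 subr_eq0; exact.
Qed.

Lemma sqdistxx x : sqdist x x = 0.
Proof. by apply/eqP; rewrite sqdist_eq0. Qed.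

Lemma sqdist_gt0 x y : (0 < sqdist x y) = (x != y).
Proof. by rewrite lt_neqAle sqdist_ge0 andbT eq_sym sqdist_eq0. Qed.

Lemma sqdist_triangle x y z : sqdist x z <= 2 * (sqdist x y + sqdist y z).
Proof.
rewrite /sqdist -big_split/= mulr_sumr; apply: ler_sum => i _.
have -> : x ord0 i - z ord0 i = (x ord0 i - y ord0 i) + (y ord0 i - z ord0 i).
  by ring.
exact: sqrrD_le.
Qed.

Lemma dist2E x y : dist2 x y = Num.sqrt (sqdist x y).
Proof. by []. Qed.

Lemma dist2_sqr x y : dist2 x y ^+ 2 = sqdist x y.
Proof. by rewrite dist2E sqr_sqrtr// sqdist_ge0. Qed.

Lemma dist2_ge0 x y : 0 <= dist2 x y.
Proof. exact: sqrtr_ge0. Qed.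

Lemma le_dist2 (r : R) x y : 0 <= r -> (r <= dist2 x y) = (r ^+ 2 <= sqdist x y).
Proof. by move=> r0; rewrite -dist2_sqr ler_sqr// nnegrE dist2_ge0. Qed.

Lemma dist2_le (r : R) x y : 0 <= r -> (dist2 x y <= r) = (sqdist x y <= r ^+ 2).
Proof. by move=> r0; rewrite -dist2_sqr ler_sqr// nnegrE dist2_ge0. Qed.

Definition coord_bounded (K : set 'rV[R]_n) : Prop :=
  exists r : R, forall z, K z -> forall i, `|z ord0 i| <= r.

Definition sqdist_poly y : mpoly n R :=
  \sum_i (mvar i - mpolyC n (y ord0 i)) ^+ 2.

Lemma peval_sqdist_poly y z : peval (sqdist_poly y) z = sqdist z y.
Proof.
by rewrite /sqdist_poly !pevalE; apply: eq_bigr => i _; rewrite !pevalE.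
Qed.

(** Lagrange interpolation with squared distances as factors: each is a polynomial whose only real
    zero is its own node. *)
Definition lagrange s x : mpoly n R :=
  \prod_(y <- s | y != x) (mpolyC n (sqdist x y)^-1 * sqdist_poly y).

Lemma peval_lagrange s x z : peval (lagrange s x) z =
  \prod_(y <- s | y != x) ((sqdist x y)^-1 * sqdist z y).
Proof.
rewrite /lagrange !pevalE; apply: eq_bigr => y _.
by rewrite pevalM pevalC peval_sqdist_poly.
Qed.

Lemma lagrange_self s x : peval (lagrange s x) x = 1.
Proof.
rewrite peval_lagrange big1// => y yx; rewrite mulVf//.
by rewrite sqdist_eq0 eq_sym.
Qed.

Lemma lagrange_factor s x y : y \in s -> y != x ->
  exists q, lagrange s x = sqdist_poly y * q.
Proof.
move=> ys yx; rewrite /lagrange (big_rem y)//= yx [mpolyC _ _ * _]mulrC -mulrA.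
by eexists; reflexivity.
Qed.

Lemma lagrange_other s x y : y \in s -> y != x -> peval (lagrange s x) y = 0.
Proof.
move=> ys yx; have [q ->] := lagrange_factor ys yx.
by rewrite pevalM peval_sqdist_poly sqdistxx mul0r.
Qed.

Section OnBoundedSet.
Variables (K : set 'rV[R]_n) (Kb : coord_bounded K).

Lemma peval_bounded p : exists2 C, 0 <= C & forall z, K z -> `|peval p z| <= C.
Proof.
move: p; apply: mpoly_alg_ind => [c|i|p q [C C0 HC] [D D0 HD]|p q [C C0 HC] [D D0 HD]].
- by exists `|c| => // z _; rewrite pevalE.
- case: Kb => r Hr; exists `|r| => // z Kz.
  by rewrite pevalE (le_trans (Hr _ Kz i))// ler_norm.
- exists (C + D); first exact: addr_ge0.
  move=> z Kz; rewrite pevalE (le_trans (ler_normD _ _))//.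
  by rewrite lerD ?HC ?HD.
- exists (C * D); first exact: mulr_ge0.
  by move=> z Kz; rewrite pevalE normrM ler_pM ?HC ?HD.
Qed.

(** Squaring keeps the Lipschitz estimate in terms of [sqdist]. The product case is the Leibniz
    splitting, with one factor bounded on [K]. *)
Lemma peval_sq_lipschitz p x :
  exists2 C, 0 <= C & forall z, K z ->
    (peval p z - peval p x) ^+ 2 <= C * sqdist z x.
Proof.
move: p; apply: mpoly_alg_ind => [c|i|p q [C C0 HC] [D D0 HD]|p q [C C0 HC] [D D0 HD]].
- by exists 0 => // z _; rewrite !pevalE subrr expr0n mul0r.
- exists 1 => // z _; rewrite !pevalE mul1r /sqdist (bigD1 i)//= lerDl.
  by apply: sumr_ge0 => j _; exact: sqr_ge0.
- exists (2 * (C + D)); first by rewrite mulr_ge0// addr_ge0.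
  move=> z Kz; rewrite !pevalE.
  rewrite (_ : _ - _ = (peval p z - peval p x) + (peval q z - peval q x)); last by ring.
  apply: le_trans (sqrrD_le _ _) _.
  by rewrite -mulrA ler_wpM2l// mulrDl lerD ?HC ?HD.
- have [B B0 HB] := peval_bounded q.
  exists (2 * (C * B ^+ 2 + D * peval p x ^+ 2)).
    by rewrite mulr_ge0// addr_ge0// mulr_ge0// sqr_ge0.
  move=> z Kz; rewrite !pevalE.
  rewrite (_ : _ - _ = (peval p z - peval p x) * peval q z
      + (peval q z - peval q x) * peval p x); last by ring.
  apply: le_trans (sqrrD_le _ _) _.
  rewrite -mulrA ler_wpM2l// !exprMn mulrDl; apply: lerD.
    rewrite [leRHS]mulrAC ler_pM ?sqr_ge0 ?HC//.
    by rewrite -(real_normK (num_real (peval q z))) lerXn2r ?nnegrE// HB.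
  by rewrite [leRHS]mulrAC ler_wpM2r ?sqr_ge0// HD.
Qed.

(* With u the Lagrange polynomial, 1 - (1 - u)^2 = u (2 - u) interpolates the
   indicator of x on s with vanishing gradient at every point of s. *)
Lemma hermite_interpolation s :
  exists2 M, 0 <= M & exists d : nat, forall x, x \in s ->
    exists L, [/\ degree_le d L,
      peval L x = 1,
      forall y, y \in s -> y != x -> peval L y = 0,
      forall z, K z -> `|peval L z| <= M
      & (forall z, K z -> `|peval L z - 1| <= M * sqdist z x) /\
        (forall z y, K z -> y \in s -> y != x ->
          `|peval L z| <= M * sqdist z y)].
Proof.
pose L x := lagrange s x * (mpolyC n 2 - lagrange s x).
have LE x z : peval (L x) z =
    peval (lagrange s x) z * (2 - peval (lagrange s x) z) by rewrite /L pevalM pevalD pevalN pevalC.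
have [M1 M10 HM1] : exists2 M, 0 <= M & forall x, x \in s ->
    forall z, K z -> `|peval (L x) z| <= M.
  apply: common_bound => [x C C' CC' h z Kz|x _].
    exact: le_trans (h z Kz) CC'.
  by have [C _ HC] := peval_bounded (L x); exists C.
have [M2 M20 HM2] : exists2 M, 0 <= M & forall x, x \in s ->
    forall z, K z -> `|peval (L x) z - 1| <= M * sqdist z x.
  apply: common_bound => [x C C' CC' h z Kz|x _].
    by rewrite (le_trans (h z Kz))// ler_wpM2r ?sqdist_ge0.
  (* The difference is -(u - 1)^2, so the squared Lipschitz bound of u at x, where u = 1,
     suffices. *)
  have [C _ HC] := peval_sq_lipschitz (lagrange s x) x; exists C => z Kz.
  apply: le_trans (HC z Kz); rewrite LE lagrange_self; set u := peval _ z.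
  rewrite (_ : u * _ - 1 = - (u - 1) ^+ 2); last by ring.
  by rewrite normrN ger0_norm ?sqr_ge0.
have [M3 M30 HM3] : exists2 M, 0 <= M & forall x, x \in s -> forall y, y \in s ->
    forall z, K z -> y != x -> `|peval (L x) z| <= M * sqdist z y.
  apply: common_bound => [x C C' CC' h y ys z Kz yx|x xs].
    by rewrite (le_trans (h y ys z Kz yx))// ler_wpM2r ?sqdist_ge0.
  have [M M0 HM] : exists2 M, 0 <= M & forall y, y \in s ->
      forall z, K z -> y != x -> `|peval (L x) z| <= M * sqdist z y.
    apply: common_bound => [y C C' CC' h z Kz yx|y ys].
      by rewrite (le_trans (h z Kz yx))// ler_wpM2r ?sqdist_ge0.
    have [->|yx] := eqVneq y x; first by exists 0.
    have [q qE] := lagrange_factor ys yx.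
    have [C _ HC] := peval_bounded (q * (mpolyC n 2 - lagrange s x)).
    exists C => z Kz _; rewrite /L {1}qE -mulrA pevalM peval_sqdist_poly normrM.
    by rewrite ger0_norm ?sqdist_ge0// mulrC ler_wpM2r ?sqdist_ge0// HC.
  by exists M.
exists (M1 + M2 + M3); first by rewrite !addr_ge0.
exists (\max_(x <- s) msize (L x))%N => x xs; exists (L x); split.
- by rewrite /degree_le leqW// (big_rem x)//= leq_max leqnn.
- by rewrite LE lagrange_self; ring.
- by move=> y ys yx; rewrite LE lagrange_other// mul0r.
- by move=> z Kz; rewrite (le_trans (HM1 _ xs z Kz))// -addrA lerDl addr_ge0.
- split=> [z Kz|z y Kz ys yx].
    rewrite (le_trans (HM2 _ xs z Kz))// ler_wpM2r ?sqdist_ge0//.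
    by rewrite addrAC lerDr addr_ge0.
  rewrite (le_trans (HM3 _ xs y ys z Kz yx))// ler_wpM2r ?sqdist_ge0//.
  by rewrite lerDr addr_ge0.
Qed.

End OnBoundedSet.
End BoundedSets.

(** * Distance to X versus the generators of its ideal *)

Section IdealBound.
Context {R : realType} {n : nat}.
Implicit Types (x y z : 'rV[R]_n) (s : seq 'rV[R]_n) (K : set 'rV[R]_n).

Lemma prod_choice_vanishing s (f : {ffun 'I_(size s) -> 'I_n}) x : x \in s ->
  peval (\prod_(j < size s) (mvar (f j) - mpolyC n (s`_j ord0 (f j)))) x = 0.
Proof.
move=> xs; have js : (index x s < size s)%N by rewrite index_mem.
rewrite peval_prod (bigD1 (Ordinal js))//= pevalD pevalN pevalC peval_var.
by rewrite nth_index// subrr mul0r.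
Qed.

(* Expanding the product of the squared distances to the points of X gives a
   sum of squares of elements of the ideal I(X): the products, over x in X, of
   one coordinate of z - x. *)
Lemma prod_sqdist_le K s k (h : 'I_k -> mpoly n R) : coord_bounded K ->
  vanishing_ideal [set` s] `<=` ideal_span h ->
  exists2 A, 0 <= A & forall z, K z ->
    \prod_(j < size s) sqdist z s`_j <= A * \sum_(i < k) peval (h i) z ^+ 2.
Proof.
move=> Kb hs.
pose q (f : {ffun 'I_(size s) -> 'I_n}) : mpoly n R :=
  \prod_(j < size s) (mvar (f j) - mpolyC n (s`_j ord0 (f j))).
have [A A0 HA] : exists2 A, 0 <= A & forall f,
    f \in enum {ffun 'I_(size s) -> 'I_n} ->
    forall z, K z -> peval (q f) z ^+ 2 <= A * \sum_(i < k) peval (h i) z ^+ 2.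
  apply: common_bound => [f C C' CC' hC z Kz|f _].
    rewrite (le_trans (hC z Kz))// ler_wpM2r//.
    by apply: sumr_ge0 => i _; exact: sqr_ge0.
  have [c qE] : ideal_span h (q f).
    by apply: hs => x /= xs; exact: prod_choice_vanishing.
  (* Cauchy-Schwarz applied to the expansion of [q f] in the generators: the constant bounds the sum
     of the squared coefficients on [K]. *)
  have [C _ HC] := peval_bounded Kb (\sum_(i < k) c i ^+ 2).
  exists C => z Kz; rewrite qE peval_sum.
  under eq_bigr do rewrite pevalM.
  apply: le_trans (cauchy_schwarz_fin _ _) _.
  apply: ler_wpM2r; first by apply: sumr_ge0 => i _; exact: sqr_ge0.
  have := HC z Kz; rewrite peval_sum; under eq_bigr do rewrite pevalX.
  exact/le_trans/ler_norm.
exists (A *+ #|{ffun 'I_(size s) -> 'I_n}|); first by rewrite mulrn_wge0.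
move=> z Kz; rewrite /sqdist bigA_distr_bigA /=.
rewrite mulrnAl -sumr_const; apply: ler_sum => f _.
apply: le_trans (HA f _ z Kz); last by rewrite mem_enum.
rewrite /q peval_prod -prodrXl; apply: ler_prod => j _.
by rewrite pevalD pevalN pevalC peval_var sqr_ge0 /=.
Qed.

(** Applied to the bounded set {z}, the product estimate forces the squared distance to some point
    of [s] to vanish. *)
Lemma vanishing_ideal_zeros s k (h : 'I_k -> mpoly n R) z :
  vanishing_ideal [set` s] `<=` ideal_span h ->
  (forall i, peval (h i) z = 0) -> z \in s.
Proof.
move=> hs hz.
have zb : coord_bounded [set z].
  exists (\sum_i `|z ord0 i|) => _ -> i; rewrite (bigD1 i)//= lerDl.
  by apply: sumr_ge0.
have [A _ /(_ z erefl)] := prod_sqdist_le zb hs.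
rewrite [X in _ * X]big1 ?mulr0; last by move=> i _; rewrite hz expr0n.
move=> p0; have : \prod_(j < size s) sqdist z s`_j == 0.
  by rewrite eq_le p0 prodr_ge0// => j _; exact: sqdist_ge0.
rewrite prodf_seq_eq0 => /hasP[j _ /=]; rewrite sqdist_eq0 => /eqP ->.
exact: mem_nth.
Qed.

Lemma generator_vanishes s k (h : 'I_k -> mpoly n R) i x :
  vanishing_ideal [set` s] = ideal_span h -> x \in s -> peval (h i) x = 0.
Proof.
move=> Xh xs; have : ideal_span h (h i).
  exists (fun j => (j == i)%:R); rewrite (bigD1 i)//= eqxx mul1r big1 ?addr0//.
  by move=> j /negbTE ->; rewrite mul0r.
by rewrite -Xh; apply.
Qed.

(** The nearest node contributes r^2. Every other node is at least half as far from z as from the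
    nearest node, whence the division by 4. The minimum over i covers all choices of nearest
    node. *)
Lemma prod_sqdist_ge s : uniq s -> exists2 B, 0 < B & forall z r,
  0 <= r <= 1 -> (forall x, x \in s -> r ^+ 2 <= sqdist z x) ->
  B * r ^+ 2 <= \prod_(j < size s) sqdist z s`_j.
Proof.
move=> us; case: (posnP (size s)) => [s0|s0].
  exists 1 => // z r /andP[r0 r1] _; rewrite mul1r.
  by rewrite [leRHS](_ : _ = 1) ?expr_le1//; move: s0; case: (s) => //; rewrite big_ord0.
pose c i := \prod_(j < size s | j != i) (sqdist s`_i s`_j / 4).
have c0 i : 0 < c i.
  apply: prodr_gt0 => j ji; rewrite divr_gt0// sqdist_gt0 nth_uniq//.
  by rewrite eq_sym.
pose i0 := Ordinal s0.
exists (\big[Num.min/c i0]_i c i).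
  by apply: lt_bigmin => // i _; exact: c0.
move=> z r /andP[r0 r1] rs.
pose i := [arg min_(i < i0) sqdist z s`_i]%O.
have im (j : 'I_(size s)) : sqdist z s`_i <= sqdist z s`_j.
  by rewrite /i; case: arg_minP => // k _ /(_ j isT).
rewrite mulrC [leRHS](bigD1 i)//=; apply: ler_pM.
- exact: sqr_ge0.
- by apply/ltW/lt_bigmin => // j _; exact: c0.
- by apply: rs; exact: mem_nth.
apply: (@le_trans _ _ (c i)); first exact: bigmin_le_cond.
apply: ler_prod => j _; rewrite divr_ge0 ?sqdist_ge0//= ler_pdivrMr//.
have := sqdist_triangle s`_i z s`_j; rewrite (sqdistC _ z).
by have := im j; lra.
Qed.

(** A Lojasiewicz inequality with exponent 2: an upper and a lower estimate of the same product of
    squared distances are compared. The radius r stands for the distance to [s] cut off at 1, which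
    keeps the case of empty [s] meaningful. *)
Lemma ideal_lower_bound K s k (h : 'I_k -> mpoly n R) : uniq s ->
  coord_bounded K -> vanishing_ideal [set` s] `<=` ideal_span h ->
  exists2 B, 0 < B & forall z r, K z -> 0 <= r <= 1 ->
    (forall x, x \in s -> r ^+ 2 <= sqdist z x) ->
    B * r ^+ 2 <= \sum_(i < k) peval (h i) z ^+ 2.
Proof.
move=> us Kb hs.
have [A A0 HA] := prod_sqdist_le Kb hs; have [B B0 HB] := prod_sqdist_ge us.
have A1 : 0 < A + 1 by rewrite ltr_wpDl.
exists (B / (A + 1)); first by rewrite divr_gt0.
move=> z r Kz r01 rs; rewrite mulrAC ler_pdivrMr// mulrC.
apply: le_trans (le_trans (HA z Kz) _).
  by rewrite mulrC; exact: HB.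
rewrite mulrC ler_wpM2l//; last by rewrite lerDl.
by apply: sumr_ge0 => i _; exact: sqr_ge0.
Qed.

End IdealBound.

(** * Peak polynomials built from a generator *)

Section PeakPoly.
Context {R : realType} {n : nat}.
Implicit Types (p : mpoly n R).

(** Uses T_(k+1) = y U_k - U_(k-1). The induction also carries the sharper bound [d * k] on U_k, the
    second component at [k.+1]. *)
Lemma degree_le_cheb d (y : mpoly n R) k : degree_le d y ->
  degree_le (d * k) (cheb y k).1.
Proof.
move=> dy; suff [] : [/\ degree_le (d * k) (cheb y k).1,
   degree_le (d * k) (cheb y k).2 & degree_le (d * k) (cheb y k.+1).2] by [].
elim: k => [|k [IH1 IH2 IH3]].
  rewrite /= mulr0 addr0 -(mpolyC1 n R) -(mpolyC0 n R).
  by split; exact: degree_leC.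
have le : (d * k <= d * k.+1)%N by rewrite leq_mul.
have IT : degree_le (d * k.+1) (cheb y k.+1).1.
  have -> : (cheb y k.+1).1 = y * (cheb y k.+1).2 - (cheb y k).2.
    by rewrite !chebS /=; ring.
  apply: degree_leD; last exact/degree_leN/(degree_leS le).
  by rewrite mulnS; exact: degree_leM.
split => //; first exact: degree_leS IH3.
rewrite [cheb y k.+2]chebS /=; apply: degree_leD => //.
by rewrite mulnS; exact: degree_leM.
Qed.

Definition peak_poly (k : nat) (H : R) p : mpoly n R :=
  let e : R := 2 / k%:R ^+ 2 in
  ((cheb (1 + e) k).1 - 1)^-1 *:
    ((cheb (mpolyC n (1 + e) - (H^-1 *: p) ^+ 2) k).1 - mpolyC n 1).

Lemma peval_peak_poly k H p z :
  peval (peak_poly k H p) z = cheb_peak k (peval p z / H).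
Proof.
rewrite /peak_poly pevalZ pevalD pevalN pevalC /cheb_peak [RHS]mulrC.
congr (_ * (_ - _)).
have [hc _] := rmorph_cheb (meval (z ord0))
  (mpolyC n (1 + 2 / k%:R ^+ 2) - (H^-1 *: p) ^+ 2) k.
apply: etrans hc _; congr (cheb _ k).1.
rewrite -[LHS]/(peval (mpolyC n (1 + 2 / k%:R ^+ 2) - (H^-1 *: p) ^+ 2) z).
rewrite pevalD pevalN pevalX pevalC pevalZ.
by rewrite [H^-1 * _]mulrC.
Qed.

(** The factor 2 is there because the Chebyshev polynomial is applied to a quadratic expression in
    p. *)
Lemma degree_le_peak_poly g k H p : degree_le g p ->
  degree_le (2 * k * g) (peak_poly k H p).
Proof.
move=> dp; rewrite /peak_poly -mul_mpolyC -[(2 * k * g)%N]add0n.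
apply: degree_leM; first exact: degree_leC.
apply: degree_leD; last exact/degree_leN/(degree_leS _ (degree_leC 0 1)).
rewrite mulnAC; apply: degree_le_cheb.
apply: degree_leD; first exact: degree_leS (degree_leC 0 _).
apply: degree_leN; rewrite expr2 mul2n -addnn -mul_mpolyC.
by apply: degree_leM; rewrite -[g]add0n; apply: degree_leM => //;
  exact: degree_leC.
Qed.

End PeakPoly.

(** * Integrals against finitely supported measures and charges *)

Section AtomicIntegral.
Context d (T : measurableType d) (R : realType).
Local Notation measure := {finite_measure set T -> \bar R}.

Lemma integrable_bounded (m : measure) (K : set T) (f : T -> R) (M : R) :
  measurable K -> measurable_fun K f -> (forall z, K z -> `|f z| <= M) ->
  m.-integrable K (EFin \o f).
Proof.
move=> mK mf fM; apply: measurable_bounded_integrable => //.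
  by rewrite ltey_eq fin_num_measure.
exists M; split; first exact: num_real.
by move=> x Mx z Kz /=; rewrite (le_trans (fM z Kz))// ltW.
Qed.

Lemma measurable_seq (S : seq T) :
  (forall z : T, measurable [set z]) -> measurable [set` S].
Proof.
move=> m1; elim: S => [|y S IH]; first by rewrite (_ : [set` _] = set0)// -subset0.
rewrite (_ : [set` _] = [set y] `|` [set` S]); first exact: measurableU.
by apply/seteqP; split=> z /=; rewrite inE => /predU1P.
Qed.

Lemma integral_finite_set (m : measure) (S : seq T) (f : T -> R) :
  uniq S -> (forall z : T, measurable [set z]) ->
  (\int[m]_(z in [set` S]) (f z)%:E =
     (\sum_(z <- S) f z * fine (m [set z]))%:E)%E.
Proof.
move=> + m1; elim: S => [_|x S IH /= /andP[xS uS]].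
  by rewrite big_nil (_ : [set` [::]] = set0) ?integral_set0// -subset0.
(* Every function is measurable on a finite set, whose subsets are finite and hence measurable. *)
have mf A : finite_set A -> measurable_fun A f.
  move=> finA _ Y _; have /finite_seqP[s ->] : finite_set (A `&` f @^-1` Y).
    by apply: sub_finite_set finA; exact: subIsetl.
  exact: measurable_seq.
rewrite (_ : [set` _] = [set x] `|` [set` S]); last first.
  by apply/seteqP; split=> z /=; rewrite inE => /predU1P.
rewrite integral_setU//; last first.
- by apply/disj_setPS => z [-> /=]; rewrite (negbTE xS).
- by apply/measurable_EFinP/mf; rewrite finite_setU; split => //; exact: finite_seq.
- exact: measurable_seq.
rewrite IH// big_cons EFinD; congr (_ + _)%E.
rewrite (eq_integral (cst (f x)%:E)); last by move=> z; rewrite inE => ->.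
by rewrite integral_cst// EFinM fineK// fin_num_measure.
Qed.

Lemma Rintegral_atomic (m : measure) (K : set T) (S : seq T) (f : T -> R)
    (M : R) : uniq S -> (forall z : T, measurable [set z]) ->
  measurable K -> [set` S] `<=` K -> m (K `\` [set` S]) = 0%E ->
  measurable_fun K f -> (forall z, K z -> `|f z| <= M) ->
  Rintegral m K f = \sum_(z <- S) f z * fine (m [set z]).
Proof.
move=> uS m1 mK SK m0 mf fM; rewrite /Rintegral.
have mS := measurable_seq S m1.
have mKS : measurable (K `\` [set` S]) by exact: measurableD.
rewrite (negligible_integral mKS mK (integrable_bounded m mK mf fM) m0).
by rewrite setDD setIidr//= integral_finite_set.
Qed.

End AtomicIntegral.

(** * Borel sets and Dirac decompositions in R^n *)

Section BorelRn.
Context {R : realType} {n : nat}.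
Local Notation E := (borelRn R n).
Implicit Types (K : set E) (nu : {charge set E -> \bar R}) (f : E -> R).

Lemma open_measurable_Rn (A : set E) :
  open (A : set 'rV[R]_n) -> measurable A.
Proof. by move=> oA; exact: sub_sigma_algebra. Qed.

Lemma closed_measurable_Rn (A : set E) :
  closed (A : set 'rV[R]_n) -> measurable A.
Proof.
move=> cA; rewrite -[A]setCK; apply: measurableC.
by apply: open_measurable_Rn; exact: closed_openC.
Qed.

Lemma compact_measurable_Rn K : compact (K : set 'rV[R]_n) -> measurable K.
Proof.
move=> cK; apply: closed_measurable_Rn.
by apply: compact_closed cK; exact: norm_hausdorff.
Qed.

Lemma measurable_set1_Rn (z : E) : measurable [set z].
Proof. by apply: compact_measurable_Rn; exact: compact_set1. Qed.

Lemma compact_coord_bounded (K : set 'rV[R]_n) : compact K -> coord_bounded K.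
Proof.
move=> /compact_bounded [M [_ HM]]; exists (M + 1) => z Kz i.
have M1 : M < M + 1 by rewrite ltrDl.
apply: le_trans (HM _ M1 z Kz); rewrite [leRHS]mx_normrE.
exact: (le_bigmax _ (fun i : 'I_1 * 'I_n => `|z i.1 i.2|) (ord0, i)).
Qed.

Lemma within_continuous_measurable K f : measurable K ->
  {within (K : set 'rV[R]_n), continuous (f : 'rV[R]_n -> R)} ->
  measurable_fun K f.
Proof.
move=> mK /continuousP cf; apply: (measurability _ (RGenOpens.measurableE R)).
move=> _ [_ [a [b ->] <-]].
have oab : open (`]a, b[%classic : set R) by exact: interval_open.
have [V oV VK] := (open_subspaceP _ _).1 (cf _ oab).
rewrite setIC -VK; apply: measurableI => //; exact: open_measurable_Rn.
Qed.

Lemma peval_continuous (p : mpoly n R) : continuous (peval p).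
Proof.
move: p; apply: mpoly_alg_ind => [c|i|p q cp cq|p q cp cq] x.
- rewrite (_ : peval _ = cst c); first exact: cst_continuous.
  by apply/funext => z; rewrite pevalC.
- rewrite (_ : peval _ = fun z => z ord0 i); first exact: coord_continuous.
  by apply/funext => z; rewrite peval_var.
- rewrite (_ : peval _ = peval p \+ peval q); first by apply: continuousD; [exact: cp|exact: cq].
  by apply/funext => z; rewrite pevalD.
- rewrite (_ : peval _ = peval p \* peval q); first by apply: continuousM; [exact: cp|exact: cq].
  by apply/funext => z; rewrite pevalM.
Qed.

Lemma measurable_peval K (p : mpoly n R) : measurable K ->
  measurable_fun K (peval p : E -> R).
Proof.
move=> mK; apply: within_continuous_measurable => //.
by apply: continuous_subspaceT => x; exact: peval_continuous.
Qed.

Section Decomposition.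
Variables (K : set E) (m : set E -> \bar R) (c : E -> R).
Hypothesis mc : dirac_decomposition K m c.

Definition atoms : seq E := finmap.enum_fset (fset_set (coef_support c)).

Lemma mem_atoms z : (z \in atoms) = (c z != 0).
Proof.
case: mc => finc _ _; apply: etrans (in_fset_set finc z) _.
by apply/idP/idP => [/set_mem|h]; [|exact/mem_set].
Qed.

Lemma atoms_uniq : uniq atoms. Proof. exact: finmap.fset_uniq. Qed.

Lemma atoms_sub z : z \in atoms -> K z.
Proof. by rewrite mem_atoms; case: mc => _ + _; exact. Qed.

Lemma set_atoms : [set` atoms] = coef_support c.
Proof. by apply/seteqP; split => z /=; rewrite mem_atoms. Qed.

Lemma atomsE A : measurable A ->
  m A = (\sum_(z <- atoms) c z * \1_A z)%:E.
Proof.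
move=> mA; case: mc => _ _ ->//; rewrite -set_atoms -fsbig_seq ?atoms_uniq//.
by rewrite -sumEFin; apply: eq_bigr => z _; rewrite EFinM.
Qed.

(** Since coefficients are masses of singletons, two decompositions of the same measure agree even
    when taken relative to different sets. *)
Lemma atom_coef z : m [set z] = (c z)%:E.
Proof.
rewrite atomsE; last exact: measurable_set1_Rn.
congr (_%:E).
have [zS|] := boolP (z \in atoms).
  rewrite (bigD1_seq z)//= ?atoms_uniq// indicE mem_set// mulr1.
  rewrite big1 ?addr0// => y yz; rewrite indicE memNset ?mulr0//.
  exact/eqP.
rewrite mem_atoms negbK => /eqP cz; rewrite cz big_seq big1// => y.
rewrite mem_atoms => cy; rewrite indicE memNset ?mulr0//= => yz.
by move: cy; rewrite yz cz eqxx.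
Qed.

Lemma null_off_atoms A : measurable A -> A `&` [set` atoms] = set0 -> m A = 0%E.
Proof.
move=> mA A0; rewrite atomsE// big_seq big1// => z zS.
rewrite indicE memNset ?mulr0// => Az.
by have : (A `&` [set` atoms]) z by []; rewrite A0.
Qed.

Lemma dirac_decomposition_lives_on : lives_on K m.
Proof.
move=> A mA AK; apply: null_off_atoms => //.
by rewrite -subset0 -AK => z [Az /atoms_sub].
Qed.

End Decomposition.

(** The Hahn decomposition is arbitrary because [charge_integral] picks one by choice. Both Jordan
    parts vanish on [K] off the atoms, and their difference at {z} is [c z]. *)
Lemma jordan_integral_atomic K nu (c : E -> R) f (M : R) (P N : set E)
    (HN : hahn_decomposition nu P N) :
  dirac_decomposition K nu c -> measurable K -> measurable_fun K f ->
  (forall z, K z -> `|f z| <= M) ->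
  Rintegral (jordan_pos HN) K f - Rintegral (jordan_neg HN) K f =
  \sum_(z <- atoms c) c z * f z.
Proof.
move=> nuc mK mf fM.
have m1 := @measurable_set1_Rn.
have mP : measurable P by case: HN => -[].
have mN : measurable N by case: HN => _ [].
have SK : [set` atoms c] `<=` K by move=> z /=; exact: (atoms_sub nuc).
have mKS : measurable (K `\` [set` atoms c]).
  by apply: measurableD => //; exact: measurable_seq.
have uS := atoms_uniq c.
have jpE A : measurable A -> jordan_pos HN A = nu (A `&` P).
  by move=> mA; rewrite jordan_posE cjordan_posE /crestr0 mem_set.
have jnE A : measurable A -> jordan_neg HN A = (- nu (A `&` N))%E.
  by move=> mA; rewrite jordan_negE cjordan_negE /crestr0 mem_set.
rewrite (@Rintegral_atomic _ _ _ (jordan_pos HN) K (atoms c) f M)//; last first.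
  apply: etrans (jpE _ mKS) _.
  apply: (null_off_atoms nuc); first exact: measurableI.
  by rewrite -subset0 => z [[[_ h] _] /h].
rewrite (@Rintegral_atomic _ _ _ (jordan_neg HN) K (atoms c) f M)//; last first.
  apply: etrans (jnE _ mKS) _.
  rewrite (null_off_atoms nuc) ?oppe0//; first exact: measurableI.
  by rewrite -subset0 => z [[[_ h] _] /h].
rewrite -sumrB; apply: eq_bigr => z _; rewrite -mulrBr mulrC; congr (_ * _).
apply: EFin_inj; rewrite -(atom_coef nuc) (jordan_decomp HN)// /cadd/= cscaleN1.
by rewrite EFinB !fineK// fin_num_measure.
Qed.

Lemma charge_integral_atomic K nu (c : E -> R) f (M : R) :
  dirac_decomposition K nu c -> measurable K -> measurable_fun K f ->
  (forall z, K z -> `|f z| <= M) ->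
  charge_integral nu K f = \sum_(z <- atoms c) c z * f z.
Proof. exact: jordan_integral_atomic. Qed.

Lemma Rintegral_dirac_decomposition K (m : {finite_measure set E -> \bar R})
    (c : E -> R) f (M : R) :
  dirac_decomposition K m c -> measurable K -> measurable_fun K f ->
  (forall z, K z -> `|f z| <= M) ->
  Rintegral m K f = \sum_(z <- atoms c) c z * f z.
Proof.
move=> mc mK mf fM; rewrite (@Rintegral_atomic _ _ _ m K (atoms c) f M)//.
- by apply: eq_bigr => z _; rewrite (atom_coef mc) mulrC.
- exact: atoms_uniq.
- exact: measurable_set1_Rn.
- by move=> z /=; exact: (atoms_sub mc).
- apply: (null_off_atoms mc); last by rewrite setDE -setIA setICl setI0.
  by apply: measurableD => //; apply: measurable_seq; exact: measurable_set1_Rn.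
Qed.

End BorelRn.

(** * Total variation of discrete charges *)

Section TotalVariation.
Context {R : realType} {n : nat}.
Local Notation E := (borelRn R n).
Variables (K : set E) (K_compact : compact (K : set 'rV[R]_n)).
Implicit Types (nu : {charge set E -> \bar R}) (c : E -> R).

Let mK : measurable K. Proof. exact: compact_measurable_Rn. Qed.

Lemma tv_test_le nu c r : dirac_decomposition K nu c ->
  (exists f : 'rV[R]_n -> R,
    [/\ {within (K : set 'rV[R]_n), continuous f},
        forall x, K x -> `|f x| <= 1
      & r = charge_integral nu K f]) ->
  r <= \sum_(z <- atoms c) `|c z|.
Proof.
move=> nuc [f [cf f1 ->]].
rewrite (charge_integral_atomic nuc mK _ f1); last first.
  exact: within_continuous_measurable.
rewrite big_seq [leRHS]big_seq; apply: ler_sum => z zS.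
rewrite (le_trans (ler_norm _))// normrM ler_piMr// f1//.
exact: (atoms_sub nuc).
Qed.

(* A continuous function with values in [-1, 1] equal to the sign of c at the
   atoms: apply q -> 2 q / (1 + q^2) to an interpolating polynomial. *)
Lemma le_tv_norm nu c : dirac_decomposition K nu c ->
  \sum_(z <- atoms c) `|c z| <= tv_norm K nu.
Proof.
move=> nuc; pose S := atoms c.
pose q : mpoly n R := \sum_(w <- S) Num.sg (c w) *: lagrange S w.
have qS z : z \in S -> peval q z = Num.sg (c z).
  move=> zS; rewrite peval_sum (bigD1_seq z)//= ?atoms_uniq//.
  rewrite pevalZ lagrange_self mulr1 big_seq_cond big1 ?addr0// => w /andP[wS wz].
  by rewrite pevalZ lagrange_other ?mulr0// eq_sym.
have q0 z : 1 + peval q z ^+ 2 != 0.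
  by rewrite gt_eqF// ltr_pwDl// sqr_ge0.
pose f z := 2 * peval q z / (1 + peval q z ^+ 2).
have f1 z : `|f z| <= 1.
  rewrite /f; set u := peval q z in q0 *.
  have u0 : 0 < 1 + u ^+ 2 by rewrite ltr_pwDl// sqr_ge0.
  rewrite ler_norml ler_pdivlMr// ler_pdivrMr//.
  have := sqr_ge0 (u - 1); have := sqr_ge0 (u + 1).
  by move=> h1 h2; apply/andP; split; nra.
have cf : {within (K : set 'rV[R]_n), continuous f}.
  apply: continuous_subspaceT => z; pose g : mpoly n R := mpolyC n 1 + q ^+ 2.
  have gE x : peval g x = 1 + peval q x ^+ 2 by rewrite !pevalE.
  rewrite (_ : f = peval (2 *: q) \* (fun x => (peval g x)^-1)); last first.
    by apply/funext => x; rewrite /f/= gE pevalZ.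
  apply: continuousM; first exact: peval_continuous.
  by apply: continuousV; [rewrite gE|exact: peval_continuous].
apply: sup_upper_bound.
  split; last first.
    by exists (\sum_(z <- S) `|c z|) => r; exact: tv_test_le.
  exists (charge_integral nu K f); exists f; split => // x _; exact: f1.
exists f; split => //.
have mf := within_continuous_measurable mK cf.
rewrite (charge_integral_atomic nuc mK mf (M := 1))//.
apply: eq_big_seq => z zS; rewrite /f qS// normrEsg mulrC.
have : c z != 0 by rewrite -(mem_atoms nuc).
by rewrite sqr_sg => -> /=; field.
Qed.

Lemma tv_norm_le nu c : dirac_decomposition K nu c ->
  tv_norm K nu <= \sum_(z <- atoms c) `|c z|.
Proof.
move=> nuc; apply: ge_sup; last by move=> r; exact: tv_test_le.
exists (charge_integral nu K (cst 0)); exists (cst 0); split => //.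
  by apply: continuous_subspaceT => z; exact: cst_continuous.
by move=> x _; rewrite normr0.
Qed.

End TotalVariation.

(** * Moments in an orthonormal polynomial basis *)

Section Duality.
Context {R : realType} {n : nat}.
Local Notation E := (borelRn R n).
Variables (K : set E) (K_compact : compact (K : set 'rV[R]_n)).

Let mK : measurable K. Proof. exact: compact_measurable_Rn. Qed.

Section Parseval.
Variable rho : probability E R.
Implicit Types (p q : mpoly n R).

Let I p := Rintegral rho K (peval p).

Let intp p : rho.-integrable K (EFin \o (peval p : E -> R)).
Proof.
have [M _ HM] := peval_bounded (compact_coord_bounded K_compact) p.
exact: integrable_bounded (measurable_peval p mK) HM.
Qed.

Let I_D p q : I (p + q) = I p + I q.
Proof.
rewrite /I -RintegralD//; try exact: intp.
by apply: eq_Rintegral => z _; exact: mevalD.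
Qed.

Let I_Z a p : I (a *: p) = a * I p.
Proof.
rewrite /I -RintegralZl//; try exact: intp.
by apply: eq_Rintegral => z _; exact: mevalZ.
Qed.

Let I_sum k (F : 'I_k -> mpoly n R) : I (\sum_i F i) = \sum_i I (F i).
Proof.
elim/big_ind2: _ => // [|p1 p2 x y <- <-]; last exact: I_D.
by rewrite -(scale0r (0 : mpoly n R)) I_Z mul0r.
Qed.

(** Parseval: the sum of the squared coefficients is the integral of p^2 against a probability
    measure, hence at most M^2. *)
Lemma orthonormal_coef_le T (phi : 'I_T -> mpoly n R) (a : 'I_T -> R) (M : R) :
  is_orthonormal K rho phi -> 0 <= M ->
  (forall z, K z -> `|peval (\sum_i a i *: phi i) z| <= M) ->
  norm2 a <= M.
Proof.
move=> orth M0 HM; set p := \sum_i a i *: phi i in HM.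
have phiE i j : I (phi i * phi j) = (i == j)%:R.
  by rewrite -orth; apply: eq_Rintegral => z _; exact: mevalM.
have Ipp : I (p * p) = \sum_i a i ^+ 2.
  rewrite {1}/p mulr_suml I_sum; apply: eq_bigr => i _.
  rewrite mulr_sumr I_sum (bigD1 i)//= big1 ?addr0 => [|j ji].
    by rewrite -scalerAl -scalerAr !I_Z phiE eqxx mulr1.
  by rewrite -scalerAl -scalerAr !I_Z phiE eq_sym (negbTE ji) !mulr0.
rewrite /norm2 -Ipp -(ger0_norm M0) -sqrtr_sqr; apply: ler_wsqrtr.
rewrite (@le_trans _ _ (Rintegral rho K (cst (M ^+ 2))))//.
  apply: le_Rintegral => //; first exact: intp.
    by apply: (@integrable_bounded _ _ _ _ _ _ `|M ^+ 2|).
  move=> z Kz; rewrite [leLHS](mevalM (z ord0) p p) -expr2 -/(peval p z).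
  by rewrite -(real_normK (num_real (peval p z))) lerXn2r ?nnegrE// HM.
rewrite Rintegral_cst// ler_piMr ?sqr_ge0//.
by rewrite -lee_fin fineK ?fin_num_measure// probability_le1.
Qed.

End Parseval.

(** Expanding p in the basis turns both sums into pairings of moment vectors with its coefficient
    vector, of norm at most M by Parseval. Passing through the moments [mu] costs M delta on each
    side, by Cauchy-Schwarz. *)
Lemma moment_gap d T (phi : 'I_T -> mpoly n R) (rho : probability E R)
    (x y mu : 'I_T -> R) (S S' : seq E) (b a : E -> R) (delta M : R) p :
  is_basis_degree_le d phi -> is_orthonormal K rho phi ->
  (forall i, x i = \sum_(z <- S) b z * peval (phi i) z) ->
  (forall i, y i = \sum_(z <- S') a z * peval (phi i) z) ->
  norm2 (fun i => x i - mu i) <= delta ->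
  norm2 (fun i => mu i - y i) <= delta ->
  degree_le d p -> 0 <= M -> (forall z, K z -> `|peval p z| <= M) ->
  `|\sum_(z <- S) b z * peval p z - \sum_(z <- S') a z * peval p z|
    <= 2 * delta * M.
Proof.
move=> [_ _ span] orth xE yE dx dy dp M0 HM.
have [c pE] := span p dp.
have cM : norm2 c <= M by apply: (orthonormal_coef_le orth) => //; rewrite -pE.
have sumE (U : seq E) (w : E -> R) (v : 'I_T -> R) :
    (forall i, v i = \sum_(z <- U) w z * peval (phi i) z) ->
    \sum_(z <- U) w z * peval p z = \sum_i c i * v i.
  move=> vE; under [RHS]eq_bigr do rewrite vE mulr_sumr.
  rewrite exchange_big/=; apply: eq_bigr => z _.
  rewrite pE peval_sum mulr_sumr; apply: eq_bigr => i _.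
  by rewrite pevalZ mulrCA.
have CS (v : 'I_T -> R) : norm2 v <= delta -> `|\sum_i c i * v i| <= M * delta.
  move=> vd; apply: (@le_trans _ _ (norm2 c * norm2 v)); last first.
    by rewrite ler_pM// sqrtr_ge0.
  rewrite -sqrtr_sqr /norm2 -sqrtrM; last by apply: sumr_ge0 => i _; exact: sqr_ge0.
  exact/ler_wsqrtr/cauchy_schwarz_fin.
rewrite (sumE _ _ _ xE) (sumE _ _ _ yE) -sumrB.
rewrite (_ : \sum_i _ = \sum_i c i * (x i - mu i) + \sum_i c i * (mu i - y i)).
  rewrite (le_trans (ler_normD _ _))//.
  by have := CS _ dx; have := CS _ dy; lra.
by rewrite -big_split/=; apply: eq_bigr => i _; ring.
Qed.

End Duality.

(** * Mass of the minimizer away from X *)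

Section DistSet.
Context {R : realType} {n : nat}.
Implicit Types (z : 'rV[R]_n) (s : seq 'rV[R]_n).

Lemma dist_set_seq s z :
  (s = [::] /\ dist_set [set` s] z = +oo%E) \/
  exists2 x, x \in s & (forall y, y \in s -> sqdist z x <= sqdist z y) /\
    dist_set [set` s] z = (dist2 z x)%:E.
Proof.
case: s => [|x0 s].
  left; split => //; rewrite /dist_set (_ : [set _ | _ in _] = set0).
    exact: ereal_inf0.
  by rewrite -subset0 => r [].
right; set t := x0 :: s.
have t0 : (0 < size t)%N by [].
pose i := [arg min_(i < Ordinal t0) sqdist z t`_i]%O.
have im y : y \in t -> sqdist z t`_i <= sqdist z y.
  move=> yt; rewrite /i; case: arg_minP => // j _.
  have jy : (index y t < size t)%N by rewrite index_mem.
  by move=> /(_ (Ordinal jy) isT) /=; rewrite nth_index.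
exists t`_i; first exact: mem_nth.
split => //; apply/eqP; rewrite eq_le; apply/andP; split.
  by apply: ereal_inf_lbound; exists t`_i => //=; exact: mem_nth.
apply: le_ereal_inf_tmp => _ [y /= yt <-]; rewrite lee_fin.
by rewrite ler_wsqrtr// -!/(sqdist _ _) im.
Qed.

Lemma far_setP s z (r : R) : 0 <= r -> (r%:E <= dist_set [set` s] z)%E ->
  forall x, x \in s -> r ^+ 2 <= sqdist z x.
Proof.
move=> r0 rz x xs; rewrite -le_dist2// -lee_fin (le_trans rz)//.
by apply: ereal_inf_lbound; exists x.
Qed.

(** A finite upper bound on the distance rules out empty [s], so [fine] does not meet its default
    value at infinity. *)
Lemma near_setP s z (r : R) : 0 <= r -> (dist_set [set` s] z <= r%:E)%E ->
  exists2 x, x \in s & [/\ forall y, y \in s -> sqdist z x <= sqdist z y,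
    fine (dist_set [set` s] z) ^+ 2 = sqdist z x & sqdist z x <= r ^+ 2].
Proof.
move=> r0; have [[_ ->]|[x xs [xm ->]]] := dist_set_seq s z; first by [].
by rewrite lee_fin dist2_le// => zx; exists x => //; split => //=; rewrite dist2_sqr.
Qed.

Lemma diameter_gt0 (K : set 'rV[R]_n) x y : coord_bounded K -> K x -> K y ->
  x != y -> 0 < diameter K.
Proof.
move=> Kb Kx Ky xy.
have [C C0 HC] := peval_bounded Kb (sqdist_poly 0).
apply: (@lt_le_trans _ _ (dist2 x y)).
  by rewrite sqrtr_gt0 -/(sqdist x y) sqdist_gt0.
apply: sup_upper_bound; last by exists x, y.
split; first by exists (dist2 x y), x, y.
exists (Num.sqrt (2 * (C + C))) => r [u [v [Ku Kv ->]]].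
apply: ler_wsqrtr; apply: le_trans (sqdist_triangle u 0 v) _.
rewrite ler_wpM2l// (sqdistC 0 v) -!peval_sqdist_poly.
by rewrite lerD// (le_trans (ler_norm _))// HC.
Qed.

End DistSet.

(** Subadditivity of the cutoff at 1, which passes from the bounds on single peaks to their sum over
    the generators. *)
Lemma min1_sum (R : realDomainType) k (x : 'I_k -> R) :
  (forall i, 0 <= x i) ->
  Num.min 1 (\sum_i x i) <= \sum_i Num.min 1 (x i).
Proof.
move=> x0; suff [] : Num.min 1 (\sum_i x i) <= \sum_i Num.min 1 (x i) /\
  0 <= \sum_i x i /\ 0 <= \sum_i Num.min 1 (x i) by [].
apply: (big_ind2 (fun u v => Num.min 1 u <= v /\ 0 <= u /\ 0 <= v)).
- by rewrite ge_min lexx orbT.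
- move=> u v u' v' [h1 [h2 h3]] [h4 [h5 h6]]; split; last first.
    by rewrite !addr_ge0.
  by move: h1 h4; rewrite !ge_min => /orP[]h /orP[]h'; apply/orP;
    [left|left|left|right]; lra.
- by move=> i _; rewrite lexx le_min ler01 x0.
Qed.

(** Each polynomial is the peak of a rescaled generator. Generators vanish on [s], so the peaks
    equal 1 there; elsewhere the lower bound on the sum of squared generators makes their total
    drop. The constant is independent of m. *)
Lemma peak_family (R : realType) (n : nat) (K : set 'rV[R]_n)
    (s : seq 'rV[R]_n) (k g : nat) (h : 'I_k -> mpoly n R) :
  uniq s -> coord_bounded K -> (forall i, degree_le g (h i)) ->
  vanishing_ideal [set` s] = ideal_span h ->
  exists2 B, 0 < B & forall m : nat, (2 <= m)%N ->
  exists q : 'I_k -> mpoly n R,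
    [/\ forall i, degree_le (2 * (m - 1) * g) (q i),
        forall i z, K z -> `|peval (q i) z| <= 1,
        forall i x, x \in s -> peval (q i) x = 1
      & forall z r, K z -> 0 <= r <= 1 ->
          (forall x, x \in s -> r ^+ 2 <= sqdist z x) ->
          Num.min 1 (m%:R ^+ 2 * B * r ^+ 2) <=
            \sum_i (1 - peval (q i) z)].
Proof.
move=> us Kb hg Xh.
have [B B0 HB] : exists2 B, 0 < B & forall z r, K z -> 0 <= r <= 1 ->
    (forall x, x \in s -> r ^+ 2 <= sqdist z x) ->
    B * r ^+ 2 <= \sum_(i < k) peval (h i) z ^+ 2.
  by apply: ideal_lower_bound => //; rewrite Xh.
have [C C0 HC] : exists2 C, 0 <= C & forall i, i \in enum 'I_k ->
    forall z, K z -> `|peval (h i) z| <= C.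
  apply: common_bound => [i C C' CC' hC z Kz|i _]; first exact: le_trans (hC z Kz) CC'.
  by have [C _ HC] := peval_bounded Kb (h i); exists C.
pose H := C + 1; have H0 : 0 < H by rewrite ltr_wpDl.
(* The 8 is 4 from m^2 <= 4 (m - 1)^2 times 2 from the peak bound; H^2 comes from the rescaling. *)
exists (B / (8 * H ^+ 2)); first by rewrite divr_gt0// mulr_gt0// exprn_gt0.
move=> m m2; have m1 : (0 < m - 1)%N by lia.
exists (fun i => peak_poly (m - 1) H (h i)).
have hH i z : K z -> `|peval (h i) z / H| <= 1.
  move=> Kz; rewrite normrM normfV (gtr0_norm H0) ler_pdivrMr// mul1r.
  by rewrite (le_trans (HC i _ z Kz)) ?mem_enum// lerDl.
split.
- by move=> i; exact: degree_le_peak_poly.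
- by move=> i z Kz; rewrite peval_peak_poly; case: (cheb_peak_bound m1 (hH i z Kz)).
- move=> i x xs; rewrite peval_peak_poly (generator_vanishes _ Xh xs).
  by rewrite mul0r cheb_peak0.
move=> z r Kz r01 rs; have r0 : 0 <= r ^+ 2 := sqr_ge0 r.
pose N : R := (m - 1)%:R.
have mN : m%:R ^+ 2 <= 4 * N ^+ 2.
  rewrite /N -!natrX -natrM ler_nat; nia.
have -> : m%:R ^+ 2 * (B / (8 * H ^+ 2)) * r ^+ 2 =
    m%:R ^+ 2 / 4 * (B * r ^+ 2) / H ^+ 2 / 2 by field; rewrite gt_eqF.
apply: (@le_trans _ _
    (Num.min 1 (\sum_i (N ^+ 2 * (peval (h i) z / H) ^+ 2 / 2)))).
  rewrite le_min !ge_min lexx/=; apply/orP; right.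
  have -> : \sum_i (N ^+ 2 * (peval (h i) z / H) ^+ 2 / 2) =
      N ^+ 2 * (\sum_i peval (h i) z ^+ 2) / H ^+ 2 / 2.
    rewrite mulr_sumr !mulr_suml; apply: eq_bigr => i _.
    by field; rewrite gt_eqF.
  rewrite !ler_pM2r ?invr_gt0 ?exprn_gt0//.
  apply: ler_pM; [|exact: mulr_ge0 (ltW B0) r0| |exact: HB].
    by rewrite divr_ge0// sqr_ge0.
  by move: mN; lra.
apply: le_trans (min1_sum _) _.
  by move=> i; rewrite divr_ge0// mulr_ge0// sqr_ge0.
apply: ler_sum => i _; rewrite peval_peak_poly.
by case: (cheb_peak_bound m1 (hH i z Kz)).
Qed.

(** * Mass estimates for the minimizer from test polynomials *)

Section Estimates.
Context {R : realType} {n : nat}.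
Variables (K : set 'rV[R]_n) (s S S' : seq 'rV[R]_n) (a b : 'rV[R]_n -> R).
Variables (d : nat) (delta : R).
Hypothesis gap : forall p M, degree_le d p -> 0 <= M ->
  (forall z, K z -> `|peval p z| <= M) ->
  `|\sum_(z <- S) b z * peval p z - \sum_(z <- S') a z * peval p z|
    <= 2 * delta * M.
Hypothesis tv_le : \sum_(z <- S) `|b z| <= \sum_(z <- S') a z.
Hypotheses (S_sub_K : forall z, z \in S -> K z)
  (S'_sub_s : forall z, z \in S' -> z \in s).

(* Since q = 1 on X, the sum of a q is the mass of a, which bounds the sum of
   |b|; hence the sum of the nonnegative terms |b| - b q is at most 2 delta. *)
Lemma sum_norm_sub_le (q : mpoly n R) : degree_le d q ->
  (forall z, K z -> `|peval q z| <= 1) ->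
  (forall x, x \in s -> peval q x = 1) ->
  \sum_(z <- S) (`|b z| - b z * peval q z) <= 2 * delta.
Proof.
move=> dq q1 qs; have := gap dq ler01 q1.
have -> : \sum_(z <- S') a z * peval q z = \sum_(z <- S') a z.
  by apply: eq_big_seq => z /S'_sub_s/qs ->; rewrite mulr1.
by rewrite sumrB mulr1 ler_norml => /andP[+ _]; move: tv_le; lra.
Qed.

Lemma excess_le (q : mpoly n R) : degree_le d q ->
  (forall z, K z -> `|peval q z| <= 1) ->
  (forall x, x \in s -> peval q x = 1) ->
  \sum_(z <- S | 0 < b z) b z * (1 - peval q z) <= 2 * delta.
Proof.
move=> dq q1 qs; apply: le_trans (sum_norm_sub_le dq q1 qs).
rewrite big_mkcond big_seq [leRHS]big_seq; apply: ler_sum => z zS.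
case: ifPn => [bz|_]; first by rewrite gtr0_norm// mulrBr mulr1.
rewrite subr_ge0 (le_trans (ler_norm _))// normrM ler_piMr// q1//.
exact: S_sub_K.
Qed.

(** The test polynomial is the constant 1: |b| - b equals 2 |b| where b < 0 and vanishes
    elsewhere. *)
Lemma negative_mass_le : \sum_(z <- S | b z < 0) `|b z| <= delta.
Proof.
have : \sum_(z <- S) (`|b z| - b z * peval (mpolyC n (1 : R)) z) <= 2 * delta.
  apply: sum_norm_sub_le; first exact: degree_leC.
    by move=> z _; rewrite pevalC normr1.
  by move=> x _; rewrite pevalC.
suff : 2 * \sum_(z <- S | b z < 0) `|b z| <=
    \sum_(z <- S) (`|b z| - b z * peval (mpolyC n (1 : R)) z) by lra.
rewrite mulr_sumr big_mkcond; apply: ler_sum => z _; rewrite pevalC mulr1.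
case: ifPn => [bz|_]; first by rewrite ltr0_norm//; lra.
by rewrite subr_ge0 ler_norm.
Qed.

Section Peaks.
Variables (k : nat) (q : 'I_k -> mpoly n R).
Hypotheses (q_degree : forall i, degree_le d (q i))
  (q_le1 : forall i z, K z -> `|peval (q i) z| <= 1)
  (q_one : forall i x, x \in s -> peval (q i) x = 1).

Let W z : R := \sum_i (1 - peval (q i) z).

Lemma peaks_ge0 z : K z -> 0 <= W z.
Proof.
move=> Kz; apply: sumr_ge0 => i _; rewrite subr_ge0.
exact: le_trans (ler_norm _) (q_le1 i Kz).
Qed.

Lemma total_excess_le :
  \sum_(z <- S | 0 < b z) b z * W z <= 2 * k%:R * delta.
Proof.
under eq_bigr do rewrite mulr_sumr.
rewrite exchange_big/= (_ : 2 * k%:R * delta = \sum_(i < k) 2 * delta).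
  by apply: ler_sum => i _; apply: excess_le => //; [exact: q_le1|exact: q_one].
by rewrite sumr_const card_ord -mulr_natr; ring.
Qed.

(** Gives both mass estimates: w is the squared distance near X and the constant 1 far from it. *)
Lemma weighted_mass_le (P : pred 'rV[R]_n) (w : 'rV[R]_n -> R) (C : R) :
  0 <= C -> (forall z, K z -> P z -> w z <= C * W z) ->
  \sum_(z <- S | P z && (0 < b z)) b z * w z <= C * (2 * k%:R * delta).
Proof.
move=> C0 Pw; apply: le_trans (ler_wpM2l C0 total_excess_le).
rewrite mulr_sumr big_mkcond [leRHS]big_mkcond big_seq [leRHS]big_seq.
apply: ler_sum => z /S_sub_K Kz; case: (ltP 0 (b z)) => bz; rewrite ?andbF// andbT.
rewrite [leRHS]mulrCA; case: ifPn => Pz.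
  by apply: ler_wpM2l; [exact: ltW|exact: Pw].
by rewrite mulr_ge0 ?(ltW bz)// mulr_ge0 ?peaks_ge0.
Qed.

(** On [S'] the polynomial L is exactly the indicator of x; on [S] it only approximates the
    indicator of P. There negative atoms pay the uniform error M' against a mass of at most delta,
    and positive atoms pay C W against the total excess. *)
Lemma interpolation_error (L : mpoly n R) (P : pred 'rV[R]_n) x (M M' C : R) :
  x \in s -> degree_le d L -> 0 <= M -> (forall z, K z -> `|peval L z| <= M) ->
  peval L x = 1 -> (forall y, y \in s -> y != x -> peval L y = 0) ->
  0 <= M' -> (forall z, K z -> `|peval L z - (P z)%:R| <= M') ->
  0 <= C -> (forall z, K z -> `|peval L z - (P z)%:R| <= C * W z) ->
  `|\sum_(z <- S' | z == x) a z - \sum_(z <- S | P z) b z| <=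
    2 * delta * M + M' * delta + C * (2 * k%:R * delta).
Proof.
move=> xs dL M0 LM L1 L0 M'0 LM' C0 LC.
have := gap dL M0 LM.
have -> : \sum_(z <- S') a z * peval L z = \sum_(z <- S' | z == x) a z.
  rewrite [RHS]big_mkcond; apply: eq_big_seq => z /S'_sub_s zs.
  by case: eqVneq => [->|zx]; rewrite ?L1 ?mulr1// L0// mulr0.
have : `|\sum_(z <- S) b z * peval L z - \sum_(z <- S | P z) b z| <=
    M' * delta + C * (2 * k%:R * delta).
  rewrite [X in _ - X]big_mkcond -sumrB.
  apply: le_trans (ler_norm_sum _ _ _) _.
  apply: (@le_trans _ _ (M' * (\sum_(z <- S | b z < 0) `|b z|) +
      C * (\sum_(z <- S | 0 < b z) b z * W z))); last first.
    by rewrite lerD ?ler_wpM2l ?negative_mass_le ?total_excess_le.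
  rewrite !mulr_sumr [X in _ <= X + _]big_mkcond [X in _ <= _ + X]big_mkcond.
  rewrite -big_split/= big_seq [leRHS]big_seq; apply: ler_sum => z /S_sub_K Kz.
  rewrite (_ : _ - _ = b z * (peval L z - (P z)%:R)); last first.
    by case: (P z); rewrite /= ?mulr1n ?mulr0n; ring.
  rewrite normrM; case: (ltgtP (b z) 0) => bz.
  - by rewrite addr0 mulrC ler_wpM2r// LM'.
  - by rewrite add0r (gtr0_norm bz) mulrCA ler_wpM2l ?(ltW bz)// LC.
  - by rewrite bz normr0 mul0r addr0.
set u := \sum_(z <- S' | z == x) a z; set v := \sum_(z <- S | P z) b z.
set w := \sum_(z <- S) _ => h1 h2.
rewrite (_ : u - v = (w - v) - (w - u)); last by ring.
by apply: le_trans (ler_normB _ _) _; lra.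
Qed.

End Peaks.
End Estimates.

(** * Nontrivial generators, separation of the points of X, finite sums *)

Section FinalLemmas.
Context {R : realType} {n : nat}.
Implicit Types (s S : seq 'rV[R]_n) (x z : 'rV[R]_n).

(** The line through x and z has a point outside the finite set, where some generator is nonzero.
    That generator vanishes at x, so it is not constant. *)
Lemma generators_nontrivial s k g (h : 'I_k -> mpoly n R) x z :
  (forall i, degree_le g (h i)) -> vanishing_ideal [set` s] = ideal_span h ->
  x \in s -> z != x -> (0 < k)%N /\ (0 < g)%N.
Proof.
move=> hg Xh xs zx.
have [y ys] : exists y, y \notin s.
  pose t := [seq x + i%:R *: (z - x) | i <- iota 0 (size s).+1].
  have ut : uniq t.
    rewrite map_inj_uniq ?iota_uniq// => i j /addrI /eqP.
    rewrite -subr_eq0 -scalerBl scaler_eq0 [z - x == 0]subr_eq0 (negbTE zx) orbF.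
    by rewrite subr_eq0 eqr_nat => /eqP.
  have /allPn[y _ ys] : ~~ all (mem s) t; last by exists y.
  apply/negP => /allP ts; have := uniq_leq_size ut ts.
  by rewrite size_map size_iota ltnn.
have [i hi] : exists i, peval (h i) y != 0.
  apply/not_existsP => h0; move/negP: ys; apply.
  apply: (@vanishing_ideal_zeros _ _ s k h y); first by rewrite Xh.
  by move=> i; apply/eqP; have /negP := h0 i; rewrite negbK.
split; first by case: i {hi} => j; case: (k).
rewrite lt0n; apply/eqP => g0; move/negP: hi; apply; apply/eqP.
have hx := generator_vanishes i Xh xs.
have := hg i; rewrite g0 /degree_le => /msize1_polyC hE.
by move: hx; rewrite hE !pevalC.
Qed.

(** Inverting squared distances turns a lower bound into an upper one. The extra 1 keeps sigma at
    most 1, and the default inverse of 0 is harmless. *)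
Lemma separation_bound s : exists2 sigma : R, 0 < sigma <= 1 &
  forall x y, x \in s -> y \in s -> x != y -> sigma <= sqdist x y.
Proof.
have [C C0 HC] : exists2 C : R, 0 <= C & forall x, x \in s ->
    forall y, y \in s -> (sqdist x y)^-1 <= C.
  apply: common_bound => [x C C' CC' h y ys|x _].
    exact: le_trans (h y ys) CC'.
  have [C _ HC] : exists2 C : R, 0 <= C & forall y, y \in s ->
      (sqdist x y)^-1 <= C.
    apply: common_bound => [y C C' CC' h|y _]; first exact: le_trans h CC'.
    by exists (sqdist x y)^-1.
  by exists C.
have C1 : 0 < C + 1 by rewrite ltr_wpDl.
exists (C + 1)^-1; first by rewrite invr_gt0 C1 invf_le1// lerDr.
move=> x y xs ys xy; have d0 : 0 < sqdist x y by rewrite sqdist_gt0.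
rewrite -[leRHS]invrK lef_pV2 ?posrE ?invr_gt0//.
by rewrite (le_trans (HC x xs y ys))// lerDl.
Qed.

Lemma sum_single S (a : 'rV[R]_n -> R) x : uniq S ->
  (x \notin S -> a x = 0) -> \sum_(z <- S | z == x) a z = a x.
Proof.
move=> uS ax; case: (boolP (x \in S)) => xS.
  by rewrite -big_filter filter_pred1_uniq// big_seq1.
rewrite ax// big_seq_cond big1// => z /andP[zS /eqP zx].
by rewrite zx (negbTE xS) in zS.
Qed.

End FinalLemmas.

Lemma fsum_seq (R : nmodType) (T : choiceType) (S : seq T) (A : set T) (F : T -> R) : 
    uniq S ->
  (forall z, A z -> z \notin S -> F z = 0) ->
  \sum_(z \in A) F z = \sum_(z <- S | `[< A z >]) F z.
Proof.
move=> uS F0; rewrite [RHS]bigfs//; last by move=> z /asboolP Az zS; exact: (F0 z Az zS).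
by apply: eq_fsbigl; apply/seteqP; split => z /= /asboolP.
Qed.

(** * Scalar inequalities behind the constants *)

Section Arithmetic.
Variable R : realFieldType.
Implicit Types (A B C D E M k p delta sigma u v w T : R).

(** Here A = m^2, C = c0^2, u is the squared distance to X and w the total drop of the peaks. If the
    cutoff at 1 is active, u A D <= 6 is enough; otherwise D <= B gives u A D <= w. *)
Lemma near_arith A B D C u w : 0 <= u -> u <= C -> 0 < A -> 0 < D -> D <= B ->
  C * (A * D) = 6 -> (1 <= w) || (A * B * u <= w) -> u * (A * D) <= 12 * w.
Proof.
move=> u0 uC A0 D0 DB CE.
have h1 : u * (A * D) <= 6 by rewrite -CE ler_wpM2r// mulr_ge0// ltW.
have h2 : u * (A * D) <= A * B * u by rewrite mulrC ler_wpM2r// ler_wpM2l// ltW.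
have h3 : 0 <= u * (A * D) by rewrite mulr_ge0// mulr_ge0// ltW.
by case/orP; lra.
Qed.

Lemma far_arith A B D C : 0 < A -> D <= B -> 0 <= C -> C * (A * D) = 6 ->
  1 <= A * B * C.
Proof.
move=> A0 DB C0 CE.
have : A * D * C <= A * B * C by rewrite ler_wpM2r// ler_wpM2l// ltW.
by move: CE; lra.
Qed.

(** With E = m^2 D, two balls of squared radius 6 / E can meet only if the squared distance of their
    centres is at most 24 / E. *)
Lemma two_balls E C sigma u v w : 0 < E -> C * E = 6 -> 24 < E * sigma ->
  u <= C -> v <= C -> w <= 2 * (u + v) -> sigma <= w -> False.
Proof.
move=> E0 CE sE uC vC wuv sw.
have : E * sigma <= E * (4 * C) by apply: (ler_wpM2l (ltW E0)); lra.
by lra.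
Qed.

(** Here E is the squared diameter times D and p is pi^2; the hypothesis on E M is secured by the
    choice of D. *)
Lemma diameter_arith E M k p : 0 < E -> E * M <= 1 -> 4 <= p -> 0 <= k ->
  48 * k * M <= 6 * (2 * k) * p / E.
Proof.
move=> E0 EM p4 k0; rewrite ler_pdivlMr//.
have h1 := ler_wpM2l k0 EM; have h2 : k * 4 <= k * p by rewrite ler_wpM2l.
by lra.
Qed.

(** The left side is (3 M + 1 + 2 k M) delta, and 48 k M leaves ample room for the multiples of
    M. *)
Lemma error_arith delta M k T : 0 <= delta -> 0 <= M -> 1 <= k ->
  48 * k * M <= T ->
  2 * delta * M + (M + 1) * delta + M * (2 * k * delta) <=
    (2 * (k + 1) + T) * delta.
Proof.
move=> d0 M0 k1 MT; have kM : M <= k * M by rewrite ler_peMl.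
have -> : 2 * delta * M + (M + 1) * delta + M * (2 * k * delta) =
  (2 * M + (M + 1) + 2 * M * k) * delta by ring.
by rewrite ler_wpM2r//; lra.
Qed.

End Arithmetic.

(** * Choice of [D] and of the threshold for m, and the three conclusions *)

Theorem theorem1p8 (R : realType) (n : nat) (K X : set 'rV[R]_n)
    (mu Delta : {finite_measure set (borelRn R n) -> \bar R})
    (a : borelRn R n -> R) (k s g : nat) (h : 'I_s -> mpoly n R)
    (K_compact : compact K) (X_finite : finite_set X) (X_sub_K : X `<=` K)
    (mu_on_K : lives_on K mu)
    (Delta_atoms : has_atoms_at_most X k Delta)
    (Delta_coef : dirac_decomposition K Delta a)
    (h_degree : forall i, degree_le g (h i))
    (h_generates : vanishing_ideal X = ideal_span h) :
  exists2 D : R, 0 < D & exists m0 : nat, forall m : nat,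
    (m0 <= m)%N -> ~~ odd m ->
  forall (d T : nat) (phi : 'I_T -> mpoly n R)
    (rho : probability (borelRn R n) R) (delta : R)
    (hDelta : {charge set (borelRn R n) -> \bar R}) (b : borelRn R n -> R),
    (2 * (m - 1) * g <= d)%N ->
    is_basis_degree_le d phi ->
    lives_on K rho ->
    is_orthonormal K rho phi ->
    0 <= delta ->
    is_summary K phi delta k mu Delta ->
    is_minimizer K phi delta mu hDelta ->
    dirac_decomposition K hDelta b ->
  let c0 : R := m%:R^-1 * Num.sqrt (3`!%:R / D) in
  [/\ forall z, K z -> 4 * s%:R * delta < b z -> (dist_set X z <= c0%:E)%E,
      [/\ \sum_(z \in [set z | near_set K X c0 z /\ 0 < b z])
            b z * fine (dist_set X z) ^+ 2
            <= 3`!%:R * (4 * s%:R) / (m%:R ^+ 2 * D) * delta,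
          \sum_(z \in [set z | far_set K X c0 z /\ 0 < b z]) b z
            <= 2 * s%:R * delta
        & \sum_(z \in [set z | K z /\ b z < 0]) `|b z| <= 2 * delta]
    & forall xs, X xs ->
        `|a xs - \sum_(z \in [set z | K z /\ dist2 z xs <= c0]) b z|
        <= m%:R^-1 * tv_norm K (charge_of_finite_measure Delta)
           + (2 * (s%:R + 1)
              + 3`!%:R * (2 * s%:R) * pi ^+ 2 / (diameter K ^+ 2 * D)) * delta].
Proof.
have [X0 [us XE]] : exists X0 : seq 'rV[R]_n, uniq X0 /\ X = [set` X0].
  have /finite_seqP[X1 ->] := X_finite; exists (undup X1).
  split; first exact: undup_uniq.
  by apply/seteqP; split => z /=; rewrite mem_undup.
subst X.
have mK := compact_measurable_Rn K_compact.
have Kb := compact_coord_bounded K_compact.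
have sK x : x \in X0 -> K x by exact: X_sub_K.
have [B B0 peaks] := peak_family us Kb h_degree h_generates.
have [M M0 [dL hermite]] := hermite_interpolation Kb X0.
have [sigma /andP[sigma0 sigma1] sep] := separation_bound X0.
pose dm := diameter K.
have dmM : 0 < dm ^+ 2 * M + 1 by rewrite ltr_wpDl// mulr_ge0// sqr_ge0.
(* The bound by [B] makes the peaks effective at radius [c0]. The other term gives
   [dm ^+ 2 * D * M <= 1], its extra 1 covering M = 0 and diameter 0. *)
pose D := Num.min B (dm ^+ 2 * M + 1)^-1.
have D0 : 0 < D by rewrite lt_min B0 invr_gt0.
have DB : D <= B by rewrite ge_min lexx.
have DM : dm ^+ 2 * D * M <= 1.
  have : D * (dm ^+ 2 * M + 1) <= 1.
    by rewrite -ler_pdivlMr// mul1r ge_min lexx orbT.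
  by nra.
exists D => //.
(* The three thresholds serve the peak family, the degree of the interpolant, and the disjointness
   of the balls of radius [c0] about the points of X. *)
exists (maxn 2 (maxn dL.+1 (Num.truncn (24 / (D * sigma))).+1)) => m.
rewrite !geq_max => /andP[m2 /andP[dLm mtrunc]] _.
have m24 : 24 < m%:R ^+ 2 * D * sigma.
  have : 24 / (D * sigma) < m%:R.
    by rewrite (lt_le_trans (truncnS_gt _))// ler_nat.
  rewrite ltr_pdivrMr ?mulr_gt0// => /lt_le_trans; apply.
  rewrite -mulrA ler_wpM2r ?mulr_ge0 ?(ltW D0) ?(ltW sigma0)//.
  by rewrite expr2 ler_peMl// ler1n ltnW.
have m0 : 0 < m%:R :> R by rewrite ltr0n ltnW.
have mD0 : 0 < m%:R ^+ 2 * D by rewrite mulr_gt0// exprn_gt0.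
have mD24 : 24 <= m%:R ^+ 2 * D.
  by rewrite (le_trans (ltW m24))// ler_piMr// ltW.
move=> d T phi rho delta hDelta b dm1 basis _ orth delta0 [_ summary].
move=> [[hDelta_on feas] minim] hb c0.
rewrite (_ : 3`!%:R = 6 :> R)// in c0 *.
have c00 : 0 <= c0 by rewrite mulr_ge0 ?invr_ge0 ?sqrtr_ge0// ltW.
have c0E : c0 ^+ 2 * (m%:R ^+ 2 * D) = 6.
  rewrite /c0 exprMn sqr_sqrtr ?divr_ge0 ?(ltW D0)//.
  by field; rewrite !gt_eqF.
have c01 : c0 <= 1.
  by rewrite -(expr_le1 (n := 2))//; move: (sqr_ge0 c0) c0E mD24; clear; nra.
have [q [q_degree q_le1 q_one q_peak]] := peaks m m2.
have {}q_degree i : degree_le d (q i) by apply: degree_leS (q_degree i).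
pose W z := \sum_i (1 - peval (q i) z).
have W0 z : K z -> 0 <= W z by exact: peaks_ge0.
have W_near z : K z -> (dist_set [set` X0] z <= c0%:E)%E ->
    exists2 x, x \in X0 & [/\ sqdist z x <= c0 ^+ 2,
      fine (dist_set [set` X0] z) ^+ 2 = sqdist z x
      & sqdist z x <= 12 / (m%:R ^+ 2 * D) * W z].
  move=> Kz zX; have [x xs [xm fE xc]] := near_setP c00 zX.
  exists x => //; split => //.
  have r01 : 0 <= dist2 z x <= 1.
    by rewrite dist2_ge0 (le_trans _ c01)// dist2_le.
  have := q_peak z (dist2 z x) Kz r01; rewrite dist2_sqr => /(_ xm).
  rewrite ge_min -/(W z) => h1; rewrite mulrAC ler_pdivlMr//.
  move: h1.
  exact: near_arith (sqdist_ge0 z x) xc (exprn_gt0 2 m0) D0 DB c0E.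
have W_far z : K z -> (c0%:E <= dist_set [set` X0] z)%E -> 1 <= W z.
  move=> Kz zX; have c001 : 0 <= c0 <= 1 by rewrite c00.
  have := q_peak z c0 Kz c001 (far_setP c00 zX).
  apply: le_trans; rewrite le_min lexx/=.
  exact: far_arith (exprn_gt0 2 m0) DB (sqr_ge0 c0) c0E.
case: Delta_atoms => a' [Da' a'0 _].
(* The decomposition over [K] thus inherits nonnegative coefficients and a support in X from the one
   over X. *)
have aE z : a z = a' z.
  by apply: EFin_inj; rewrite -(atom_coef Delta_coef) (atom_coef Da').
have a0 z : 0 <= a z by rewrite aE.
pose S := atoms b; pose S' := atoms a.
have S_sub_K z : z \in S -> K z by exact: (atoms_sub hb).
have S'_sub_s z : z \in S' -> z \in X0.
  rewrite (mem_atoms Delta_coef) aE => az.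
  by apply: (atoms_sub Da'); rewrite (mem_atoms Da').
have DeltaC : dirac_decomposition K (charge_of_finite_measure Delta) a.
  exact: Delta_coef.
have intD i : charge_integral (charge_of_finite_measure Delta) K (peval (phi i)) =
    Rintegral Delta K (peval (phi i)).
  have [C _ HC] := peval_bounded Kb (phi i).
  rewrite (charge_integral_atomic DeltaC mK (measurable_peval _ mK) HC).
  by rewrite (Rintegral_dirac_decomposition Delta_coef mK (measurable_peval _ mK) HC).
have gap p C : degree_le d p -> 0 <= C ->
    (forall z, K z -> `|peval p z| <= C) ->
    `|\sum_(z <- S) b z * peval p z - \sum_(z <- S') a z * peval p z|
      <= 2 * delta * C.
  apply: (moment_gap K_compact basis orth _ _ feas summary) => i.
    have [C' _ HC] := peval_bounded Kb (phi i).
    exact: (charge_integral_atomic hb mK (measurable_peval _ mK) HC).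
  have [C' _ HC] := peval_bounded Kb (phi i).
  exact: (Rintegral_dirac_decomposition Delta_coef mK (measurable_peval _ mK) HC).
have tv_le : \sum_(z <- S) `|b z| <= \sum_(z <- S') a z.
  apply: le_trans (le_tv_norm K_compact hb) _.
  have -> : \sum_(z <- S') a z = \sum_(z <- S') `|a z|.
    by apply: eq_bigr => z _; rewrite ger0_norm.
  (* [Delta], seen as a charge, is feasible: the summary bound is the moment constraint up to
     sign. *)
  apply: le_trans (tv_norm_le K_compact DeltaC); apply: minim; split.
    exact: (dirac_decomposition_lives_on DeltaC).
  move: summary; rewrite /norm2; under eq_bigr do rewrite -sqrrN opprB.
  by under [in X in _ -> X]eq_bigr do rewrite intD.
have sum_S (A : set 'rV[R]_n) (F : 'rV[R]_n -> R) :
    (forall z, b z = 0 -> F z = 0) ->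
    \sum_(z \in A) F z = \sum_(z <- S | `[< A z >]) F z.
  move=> F0; apply: fsum_seq; first exact: atoms_uniq.
  by move=> z _; rewrite (mem_atoms hb) negbK => /eqP /F0.
have andE (A : set 'rV[R]_n) z : `[< A z /\ 0 < b z >] = `[< A z >] && (0 < b z).
  by rewrite asbool_and asboolb.
have weighted (A : set 'rV[R]_n) (w : 'rV[R]_n -> R) C : 0 <= C ->
    (forall z, K z -> A z -> w z <= C * W z) ->
    \sum_(z \in [set z | A z /\ 0 < b z]) b z * w z <= C * (2 * s%:R * delta).
  move=> C0 AW; rewrite sum_S; last by move=> z ->; rewrite mul0r.
  under eq_bigl do rewrite /= andE.
  apply: (weighted_mass_le gap tv_le S_sub_K S'_sub_s q_degree q_le1 q_one) => //.
  by move=> z Kz /asboolP; exact: AW.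
have far_mass : \sum_(z \in [set z | far_set K [set` X0] c0 z /\ 0 < b z]) b z
    <= 2 * s%:R * delta.
  under eq_fsbigr do rewrite -[b _]mulr1.
  rewrite -[leRHS]mul1r; apply: weighted => // z Kz [_ zX].
  by rewrite mul1r; exact: W_far.
have bK z : b z != 0 -> K z by rewrite -(mem_atoms hb); exact: S_sub_K.
split; [|split|].
- move=> z Kz bz; rewrite leNgt; apply/negP => zX.
  (* An atom this heavy and this far would by itself exceed the bound on the far mass. *)
  have bz0 : 0 < b z by apply: le_lt_trans bz; rewrite !mulr_ge0.
  have zS : z \in S by rewrite (mem_atoms hb) gt_eqF.
  move: far_mass; rewrite sum_S// (big_rem z)//= ifT; last first.
    by apply/asboolP; split => //; split => //; exact: ltW.
  set rest := \sum_(y <- _ | _) _.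
  have : 0 <= rest by apply: sumr_ge0 => y /asboolP[_ /ltW].
  have : 0 <= s%:R * delta by rewrite mulr_ge0.
  by move: bz; clear; lra.
- rewrite (_ : 6 * _ / _ * delta = 12 / (m%:R ^+ 2 * D) * (2 * s%:R * delta)).
    apply: weighted; first by rewrite divr_ge0// ltW.
    by move=> z Kz [_ zX]; have [x _ [_ -> ]] := W_near z Kz zX.
  by field; rewrite !gt_eqF.
- exact: far_mass.
- rewrite sum_S; last by move=> z ->; rewrite normr0.
  rewrite (eq_bigl (fun z => b z < 0)).
    apply: le_trans (negative_mass_le gap tv_le S'_sub_s) _.
    by rewrite ler_peMl// ler1n.
  move=> z /=; apply/asboolP/idP => [[]//|bz]; split => //.
  by apply: bK; rewrite lt_eqF.
move=> xs xsX; set P := [set z | _].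
rewrite sum_S//.
have tv0 : 0 <= tv_norm K (charge_of_finite_measure Delta).
  apply: le_trans (le_tv_norm K_compact DeltaC).
  by apply: sumr_ge0 => z _; exact: normr_ge0.
have tvm : 0 <= m%:R^-1 * tv_norm K (charge_of_finite_measure Delta).
  by rewrite mulr_ge0// invr_ge0.
have axs : \sum_(z <- S' | z == xs) a z = a xs.
  apply: sum_single; first exact: atoms_uniq.
  by rewrite (mem_atoms Delta_coef) negbK => /eqP.
rewrite -axs -/dm.
have err := interpolation_error gap tv_le S_sub_K S'_sub_s q_degree q_le1 q_one.
have pi2 : 4 <= pi ^+ 2 :> R by have := pi_ge2 R; clear; nra.
(* If K is {xs}, the diameter is 0 and the quotient by its square takes the default value 0. The
   constant 1 then serves as interpolant, with no error on K, leaving 2 delta. *)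
case: (pselect (exists2 z, K z & z != xs)) => [[z0 Kz0 z0xs]|Kxs]; last first.
  have Keq z : K z -> z = xs.
    by move=> Kz; apply/eqP/negPn/negP => zx; apply: Kxs; exists z.
  have PK z : K z -> `[< P z >] = true.
    move=> Kz; apply/asboolP; split => //.
    by rewrite (Keq z Kz) dist2_le// sqdistxx sqr_ge0.
  have := @err (mpolyC n 1) (fun z => `[< P z >]) xs 1 0 0 xsX.
  rewrite !mul0r !addr0 mulr1 => /(_ _ _ _ _ _ _ _ _ _)/le_trans; apply.
  - exact: degree_leS (degree_leC 0 1).
  - exact: ler01.
  - by move=> z _; rewrite pevalC normr1.
  - by rewrite pevalC.
  - by move=> y /sK/Keq ->; rewrite eqxx.
  - exact: lexx.
  - by move=> z /PK ->; rewrite pevalC subrr normr0.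
  - exact: lexx.
  - by move=> z /PK ->; rewrite pevalC subrr normr0 mul0r.
  have T0 : 0 <= 6 * (2 * s%:R) * pi ^+ 2 / (dm ^+ 2 * D) * delta.
    have h6 : 0 <= 6 * (2 * s%:R) :> R by rewrite !mulr_ge0.
    have dD := mulr_ge0 (sqr_ge0 dm) (ltW D0).
    exact: mulr_ge0 (divr_ge0 (mulr_ge0 h6 (sqr_ge0 pi)) dD) delta0.
  rewrite (mulrDl (2 * (s%:R + 1))) -[leLHS]add0r lerD// -[leLHS]addr0 lerD//.
  by rewrite ler_wpM2r// ler_peMr// lerDr.
have [s0 g0] := generators_nontrivial h_degree h_generates xsX z0xs.
have dm0 : 0 < dm by apply: (diameter_gt0 Kb Kz0 (sK _ xsX)).
have [L [dLL L1 L0 LM [Lx Ly]]] := hermite xs xsX.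
(* By the choice of m, the balls of radius [c0] about distinct points of X are disjoint. *)
have PN z x : x \in X0 -> x != xs -> sqdist z x <= c0 ^+ 2 -> ~ P z.
  move=> xX xxs zx [_]; rewrite dist2_le// => zxs.
  apply: (two_balls mD0 c0E m24 zx zxs _ (sep _ _ xX xsX xxs)).
  by rewrite -(sqdistC x z); exact: sqdist_triangle.
(* Within [c0] of a point of X the error of L is at most M times the squared distance, hence at most
   M W because 12 / (m^2 D) <= 1. Beyond [c0], |L| <= M <= M W. *)
have LW z : K z -> `|peval L z - `[< P z >]%:R| <= M * W z.
  move=> Kz; have [zX|zX] := leP (dist_set [set` X0] z) c0%:E.
    have [x xX [xc _ xW]] := W_near z Kz zX.
    have {}xW : sqdist z x <= W z.
      rewrite (le_trans xW)// ler_piMl ?W0// ler_pdivrMr//.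
      by rewrite mul1r (le_trans _ mD24)// ler_nat.
    apply: (@le_trans _ _ (M * sqdist z x)); last by rewrite ler_wpM2l.
    have [xxs|xxs] := eqVneq x xs.
      rewrite (_ : `[< P z >] = true); first by rewrite xxs; exact: Lx.
      by apply/asboolP; split => //; rewrite dist2_le// -xxs.
    rewrite (_ : `[< P z >] = false) ?subr0; first exact: Ly.
    by apply/asboolPn; exact: PN xc.
  rewrite (_ : `[< P z >] = false) ?subr0.
    by rewrite (le_trans (LM z Kz))// ler_peMr// W_far// ltW.
  apply/asboolPn => -[_ zxs]; move: zX; rewrite ltNge => /negP; apply.
  by apply: le_trans (_ : (dist2 z xs)%:E <= _)%E; [apply: ereal_inf_lbound; exists xs|rewrite lee_fin].
have LP z : K z -> `|peval L z - `[< P z >]%:R| <= M + 1.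
  move=> Kz; rewrite (le_trans (ler_normB _ _))// lerD ?LM//.
  by case: `[< P z >]; rewrite ?normr1 ?normr0.
have dLd : degree_le d L.
  (* From dL < m and g >= 1 it follows that dL <= 2 (m - 1) g. *)
  apply: degree_leS dLL; apply: leq_trans dm1; rewrite -[dL]muln1 leq_mul//.
  by move: dLm; clear; lia.
have M10 : 0 <= M + 1 by rewrite addr_ge0.
apply: le_trans (@err L (fun z => `[< P z >]) xs M (M + 1) M xsX dLd M0 LM L1 L0 M10 LP M0 LW) _.
have dmD : 0 < dm ^+ 2 * D by rewrite mulr_gt0// exprn_gt0.
have s1 : 1 <= s%:R :> R by rewrite ler1n.
have hM := diameter_arith dmD DM pi2 (ler0n R s).
by apply: le_trans (error_arith delta0 M0 s1 hM) _; rewrite lerDr.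
Qed.
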